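(* Let $\Lambda$ be an artin algebra and let $(\Psi,\mathbf{Q},\leq)$ be a proper costratifying system of size $t$ in $\mathrm{mod}(\Lambda)$, where $\mathbf{Q}=\{Q(i)\}_{i=1}^t$ is a set of pairwise non-isomorphic indecomposable $\Lambda$-modules. Let $Q=\bigoplus_{i=1}^tQ(i)$, $\Gamma=\mathrm{End}_\Lambda(Q)^{op}$ and $\overline{G}=\mathrm{Hom}_{\Gamma^{op}}(-,Q)$. Then the following conditions are equivalent. (a) There exists a family $\Theta=\{\Theta(i)\}_{i=1}^t$ in $\mathrm{mod}(\Lambda)$ such that $(\Theta,\mathbf{Q},\leq)$ is an Ext-injective stratifying system. (b) $\mathrm{Ext}^1_{\Gamma^{op}}({}_{\Gamma^{op}}\Delta(i),{}_{\Gamma^{op}}Q)=0$ and $\mathrm{Ext}^1_\Lambda(\overline{G}({}_{\Gamma^{op}}\Delta(i)),{}_\Lambda Q)=0$ for all $i\in[1,t]$. If these conditions hold, the system $(\Theta,\mathbf{Q},\leq)$ is uniquely determined (up to isomorphism) and $\Theta(i)\simeq\overline{G}({}_{\Gamma^{op}}\Delta(i))$ for all $i\in[1,t]$.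
   Context: $\Lambda$ is an artin $R$-algebra ($R$ a commutative artinian ring); for an artin algebra $A$, $\mathrm{mod}(A)$ is the category of finitely generated left $A$-modules; $[1,t]=\{1,\dots,t\}$. For a class $\mathcal{X}$ of modules, $\mathcal{F}(\mathcal{X})$ is the class of modules having a finite filtration with all factors isomorphic to modules in $\mathcal{X}$ (it contains $0$). A proper costratifying system $(\Psi,\mathbf{Q},\leq)$ of size $t$ in $\mathrm{mod}(\Lambda)$ consists of two families of $\Lambda$-modules $\Psi=\{\Psi(i)\}_{i=1}^t$ and $\mathbf{Q}=\{Q(i)\}_{i=1}^t$, with $Q(i)$ indecomposable for all $i$, and a linear order $\leq$ on $[1,t]$ such that: (a) $\mathrm{End}_\Lambda(\Psi(i))$ is a division ring for all $i$; (b) $\mathrm{Hom}_\Lambda(\Psi(i),\Psi(j))=0$ if $i<j$; (c) for each $i$ there is an exact sequence $0\to Z(i)\to Q(i)\to\Psi(i)\to 0$ with $Z(i)\in\mathcal{F}(\{\Psi(j):j\leq i\})$; (d) $\mathrm{Ext}^1_\Lambda(Q(i),\Psi(j))=0$ for all $i,j\in[1,t]$. An Ext-injective stratifying system $(\Theta,\underline{Y},\leq)$ of size $t$ in $\mathrm{mod}(\Lambda)$ consists of two families of non-zero $\Lambda$-modules $\Theta=\{\Theta(i)\}_{i=1}^t$ and $\underline{Y}=\{Y(i)\}_{i=1}^t$, with $Y(i)$ indecomposable for all $i$, and a linear order $\leq$ on $[1,t]$ such that: (a) $\mathrm{Hom}_\Lambda(\Theta(i),\Theta(j))=0$ if $i>j$;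 (b) for each $i$ there is an exact sequence $0\to\Theta(i)\to Y(i)\to Z(i)\to0$ with $Z(i)\in\mathcal{F}(\{\Theta(j):j<i\})$; (c) $\mathrm{Ext}^1_\Lambda(\Theta(j),Y)=0$ for all $j$, where $Y=\bigoplus_{i=1}^tY(i)$. $Q$ is a left $\Lambda$-module and a left module over $\Gamma^{op}=\mathrm{End}_\Lambda(Q)$. The indecomposable projective $\Gamma^{op}$-modules are indexed as ${}_{\Gamma^{op}}\overline{P}(i)=\mathrm{Hom}_\Lambda(Q(i),Q)$, $i\in[1,t]$. Let $\leq^{op}$ be the opposite order of $\leq$. The standard $\Gamma^{op}$-modules (computed with the order $\leq^{op}$) are ${}_{\Gamma^{op}}\Delta(i)={}_{\Gamma^{op}}\overline{P}(i)/\mathrm{Tr}_{\bigoplus_{j>^{op}i}{}_{\Gamma^{op}}\overline{P}(j)}({}_{\Gamma^{op}}\overline{P}(i))$, where $\mathrm{Tr}_M(N)$ denotes the submodule of $N$ generated by the images of all morphisms $M\to N$. *)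

(* Defs.v *)
From HB Require Import structures.
From mathcomp Require Import all_boot all_algebra boolp.

Set Implicit Arguments.
Unset Strict Implicit.
Unset Printing Implicit Defensive.

Import GRing.Theory.
Local Open Scope quotient_scope.
Local Open Scope ring_scope.

Section Submodules.
Variables (A : pzRingType) (M : lmodType A).

Record submodule := Submodule {
  submodule_pred :> {pred M};
  submoduleP : submod_closed submodule_pred }.

Fact submodule_closed (S : submodule) : subsemimod_closed S.
Proof. exact: GRing.submod_closed_semi (submoduleP S). Qed.

HB.instance Definition _ (S : submodule) :=
  GRing.isSubmodClosed.Build A M (submodule_pred S) (submodule_closed S).

Definition subm (S : submodule) : Type := {x : M | x \in S}.
HB.instance Definition _ (S : submodule) := SubChoice.on (subm S).
HB.instance Definition _ (S : submodule) :=
  [SubChoice_isSubLmodule of subm S by <:].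

Definition quotm (S : submodule) : Type := Quotient.quot (submodule_pred S).
HB.instance Definition _ (S : submodule) := GRing.Zmodule.on (quotm S).

Section QuotScale.
Variable S : submodule.
Implicit Types (a b : A) (x y : M) (u v : quotm S).

Definition quot_pi x : quotm S := \pi_(Quotient.quot (submodule_pred S)) x.
Definition quot_scale a u : quotm S :=
  quot_pi (a *: repr (u : Quotient.quot (submodule_pred S))).

Lemma quot_piP x y : reflect (quot_pi x = quot_pi y) (x - y \in S).
Proof. by rewrite Quotient.idealrBE; apply: eqP. Qed.

Lemma quot_pi_repr u : quot_pi (repr (u : Quotient.quot (submodule_pred S))) = u.
Proof. exact: reprK. Qed.

Lemma quot_piD : {morph quot_pi : x y / x + y}.
Proof. exact: Quotient.pi_add. Qed.

Lemma quot_scale_pi a x : quot_scale a (quot_pi x) = quot_pi (a *: x).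
Proof.
apply/quot_piP; rewrite -scalerBr rpredZ //.
by apply/quot_piP; rewrite quot_pi_repr.
Qed.

Fact quot_scaleA a b u : quot_scale a (quot_scale b u) = quot_scale (a * b) u.
Proof. by rewrite -[u]quot_pi_repr !quot_scale_pi scalerA. Qed.

Fact quot_scale1 : left_id 1 quot_scale.
Proof. by move=> u; rewrite -[u]quot_pi_repr quot_scale_pi scale1r. Qed.

Fact quot_scaleDr : right_distributive quot_scale +%R.
Proof.
move=> a u v; rewrite -[u]quot_pi_repr -[v]quot_pi_repr -quot_piD.
by rewrite !quot_scale_pi scalerDr quot_piD.
Qed.

Fact quot_scaleDl u : {morph quot_scale^~ u : a b / a + b}.
Proof.
by move=> a b; rewrite -[u]quot_pi_repr !quot_scale_pi scalerDl quot_piD.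
Qed.

HB.instance Definition _ := GRing.Zmodule_isLmodule.Build A (quotm S)
  quot_scaleA quot_scale1 quot_scaleDr quot_scaleDl.
End QuotScale.

Section Generated.
Variable X : M -> Prop.

Definition gen_pred (y : M) : bool :=
  `[< forall U : submodule, (forall x, X x -> x \in U) -> y \in U >].

Fact gen_pred_closed : submod_closed gen_pred.
Proof.
split=> [|a x y /asboolP xU /asboolP yU]; apply/asboolP => U XU.
  exact: rpred0.
by rewrite rpredD ?rpredZ ?xU ?yU.
Qed.

Definition gen_submodule : submodule := Submodule gen_pred_closed.
End Generated.

End Submodules.

Section Factor.
Variables (A : pzRingType) (M : lmodType A).
Variables U V : submodule M.

Definition factor_pred : {pred subm V} := [pred x | val x \in U].

Fact factor_pred_closed : submod_closed factor_pred.
Proof.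
split=> [|a x y]; rewrite !inE; first by rewrite raddf0 rpred0.
by move=> xU yU; rewrite linearP rpredD ?rpredZ.
Qed.

(* V / U, for U contained in V *)
Definition factor : lmodType A := quotm (Submodule factor_pred_closed).
End Factor.

Section Homs.
Variables (A : pzRingType) (M N : lmodType A).

Definition Hom : Type := {linear M -> N}.
Implicit Types f g h : Hom.

HB.instance Definition _ := gen_eqMixin Hom.
HB.instance Definition _ := gen_choiceMixin Hom.

Lemma HomP f g : f =1 g -> f = g.
Proof.
case: f g => [f cf] [g cg] /= fg; have {}fg : f = g by apply/funext.
rewrite -{}fg in cg *; congr GRing.Linear.Pack.
case: cf cg => [[f1] [f2]] [[g1] [g2]].
by rewrite (Prop_irrelevance f1 g1) (Prop_irrelevance f2 g2).
Qed.
Definition Hom_zero : Hom := \0 : {linear M -> N}.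
Definition Hom_opp f : Hom := (\- f : {linear M -> N}).
Definition Hom_add f g : Hom := (f \+ g : {linear M -> N}).

Fact Hom_addA : associative Hom_add.
Proof. by move=> f g h; apply: HomP => x /=; rewrite addrA. Qed.
Fact Hom_addC : commutative Hom_add.
Proof. by move=> f g; apply: HomP => x /=; rewrite addrC. Qed.
Fact Hom_add0 : left_id Hom_zero Hom_add.
Proof. by move=> f; apply: HomP => x /=; rewrite add0r. Qed.
Fact Hom_addN : left_inverse Hom_zero Hom_opp Hom_add.
Proof. by move=> f; apply: HomP => x /=; rewrite addNr. Qed.

HB.instance Definition _ :=
  GRing.isZmodule.Build Hom Hom_addA Hom_addC Hom_add0 Hom_addN.
End Homs.

Section HomBuild.
Variables (A : pzRingType) (M N : lmodType A) (f : M -> N).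

Definition Hom_of (lin_f : linear f) : Hom M N :=
  HB.pack_for {linear M -> N} f (GRing.isLinear.Build A M N *:%R f lin_f).
End HomBuild.

Definition is_zero (A : pzRingType) (M : lmodType A) : Prop :=
  forall x : M, x = 0.

Definition isom (A : pzRingType) (M N : lmodType A) : Prop :=
  exists f : Hom M N, bijective f.

Definition fin_gen (A : pzRingType) (M : lmodType A) : Prop :=
  exists (n : nat) (v : 'I_n -> M),
    forall x, exists c : 'I_n -> A, x = \sum_(i < n) c i *: v i.

Definition indecomposable (A : pzRingType) (M : lmodType A) : Prop :=
  ~ is_zero M /\
  forall M1 M2 : lmodType A,
    isom M (M1 * M2)%type -> is_zero M1 \/ is_zero M2.

Section DirectSum.
Variables (A : pzRingType) (I : finType) (M : I -> lmodType A).

(* As I is finite, direct sum and product agree. *)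
Definition dsum : Type := forall i, M i.
Implicit Types (x y z : dsum) (a b : A).

HB.instance Definition _ := gen_eqMixin dsum.
HB.instance Definition _ := gen_choiceMixin dsum.

Lemma dsumP x y : (forall i, x i = y i) -> x = y.
Proof. exact: functional_extensionality_dep. Qed.

Definition dsum_zero : dsum := fun=> 0.
Definition dsum_opp x : dsum := fun i => - x i.
Definition dsum_add x y : dsum := fun i => x i + y i.
Definition dsum_scale a x : dsum := fun i => a *: x i.

Fact dsum_addA : associative dsum_add.
Proof. by move=> x y z; apply: dsumP => i; apply: addrA. Qed.
Fact dsum_addC : commutative dsum_add.
Proof. by move=> x y; apply: dsumP => i; apply: addrC. Qed.
Fact dsum_add0 : left_id dsum_zero dsum_add.
Proof. by move=> x; apply: dsumP => i; apply: add0r. Qed.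
Fact dsum_addN : left_inverse dsum_zero dsum_opp dsum_add.
Proof. by move=> x; apply: dsumP => i; apply: addNr. Qed.

HB.instance Definition _ :=
  GRing.isZmodule.Build dsum dsum_addA dsum_addC dsum_add0 dsum_addN.

Fact dsum_scaleA a b x : dsum_scale a (dsum_scale b x) = dsum_scale (a * b) x.
Proof. by apply: dsumP => i; apply: scalerA. Qed.
Fact dsum_scale1 : left_id 1 dsum_scale.
Proof. by move=> x; apply: dsumP => i; apply: scale1r. Qed.
Fact dsum_scaleDr : right_distributive dsum_scale +%R.
Proof. by move=> a x y; apply: dsumP => i; apply: scalerDr. Qed.
Fact dsum_scaleDl x : {morph dsum_scale^~ x : a b / a + b}.
Proof. by move=> a b; apply: dsumP => i; apply: scalerDl. Qed.

HB.instance Definition _ := GRing.Zmodule_isLmodule.Build A dsum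
  dsum_scaleA dsum_scale1 dsum_scaleDr dsum_scaleDl.
End DirectSum.

Section Extensions.
Variable A : pzRingType.
Implicit Types X Y Z : lmodType A.

Definition short_exact X Y Z (f : Hom X Y) (g : Hom Y Z) : Prop :=
  [/\ injective f, forall y, g y = 0 <-> exists x, f x = y
    & forall z, exists y, g y = z].

Record extension X Y := Extension {
  ext_mid : lmodType A;
  ext_in : Hom Y ext_mid;
  ext_out : Hom ext_mid X;
  ext_exact : short_exact ext_in ext_out }.

(* Such a phi is automatically an isomorphism. *)
Definition ext_equiv X Y (E E' : extension X Y) : Prop :=
  exists phi : Hom (ext_mid E) (ext_mid E'),
    (forall y, phi (ext_in E y) = ext_in E' y) /\
    (forall e, ext_out E' (phi e) = ext_out E e).

Fact inl_linear X Y : linear (fun y : Y => (y, 0) : Y * X).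
Proof. by move=> a y y'; rewrite -[RHS]/(_, a *: 0 + 0) scaler0 addr0. Qed.

Definition split_in X Y : Hom Y (Y * X)%type := Hom_of (@inl_linear X Y).
Definition split_out X Y : Hom (Y * X)%type X := (snd : {linear _ -> _}).

Fact split_exact X Y : short_exact (@split_in X Y) (@split_out X Y).
Proof.
split=> [y y' [] //|[y x]|x]; last by exists (0, x).
by split=> [/= ->|[y' [_ <-]]]; first exists y.
Qed.

Definition split_ext X Y : extension X Y := Extension (@split_exact X Y).

(* Yoneda's Ext^1(X, Y) is the set of classes of extensions of X by Y modulo
   ext_equiv, its zero element being the class of the split extension. *)
Definition Ext1_zero X Y : Prop :=
  forall E : extension X Y, ext_equiv E (split_ext X Y).

Definition Hom_zero_only X Y : Prop := forall f : Hom X Y, f = 0.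
End Extensions.

Section Filtration.
Variable A : pzRingType.

(* F(C): modules M with a chain 0 = F 0 <= F 1 <= ... <= F n = M of submodules
   whose successive factors are isomorphic to modules in the class C. *)
Definition filtered (C : lmodType A -> Prop) (M : lmodType A) : Prop :=
  exists (n : nat) (F : nat -> submodule M),
    [/\ forall x, x \in F 0 <-> x = 0,
        forall x, x \in F n
      & forall i, (i < n)%N -> {subset F i <= F i.+1} /\
          exists2 X, C X & isom (factor (F i) (F i.+1)) X].
End Filtration.

Section Endomorphisms.
Variables (A : pzRingType) (M : lmodType A).

(* The product of f and g is the composite of g followed by f. *)
Definition End : Type := Hom M M.
HB.instance Definition _ := GRing.Zmodule.on End.
Implicit Types f g h : End.

Definition End_one : End := idfun : {linear M -> M}.
Definition End_mul f g : End := (f : {linear M -> M}) \o (g : {linear M -> M}).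

Fact End_mulA : associative End_mul.
Proof. by move=> f g h; apply: HomP. Qed.
Fact End_mul1 : left_id End_one End_mul.
Proof. by move=> f; apply: HomP. Qed.
Fact End_mulr1 : right_id End_one End_mul.
Proof. by move=> f; apply: HomP. Qed.
Fact End_mulDl : left_distributive End_mul +%R.
Proof. by move=> f g h; apply: HomP. Qed.
Fact End_mulDr : right_distributive End_mul +%R.
Proof. by move=> f g h; apply: HomP => x; apply: (raddfD (f : {linear M -> M})). Qed.

HB.instance Definition _ := GRing.Zmodule_isPzRing.Build End
  End_mulA End_mul1 End_mulr1 End_mulDl End_mulDr.

(* M as a left End(M)-module *)
Definition evmod : Type := M.
HB.instance Definition _ := GRing.Zmodule.on evmod.

Definition ev_scale (f : End) (x : evmod) : evmod := f x.

Fact ev_scaleA f g x : ev_scale f (ev_scale g x) = ev_scale (f * g) x.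
Proof. by []. Qed.
Fact ev_scale1 : left_id 1 ev_scale.
Proof. by []. Qed.
Fact ev_scaleDr : right_distributive ev_scale +%R.
Proof. by move=> f; apply: (raddfD (f : {linear M -> M})). Qed.
Fact ev_scaleDl x : {morph ev_scale^~ x : f g / f + g}.
Proof. by []. Qed.

HB.instance Definition _ := GRing.Zmodule_isLmodule.Build End evmod
  ev_scaleA ev_scale1 ev_scaleDr ev_scaleDl.

Section HomInto.
Variable N : lmodType A.

(* Hom(N, M) as a left End(M)-module, acting by postcomposition *)
Definition Hom_into : Type := Hom N M.
HB.instance Definition _ := GRing.Zmodule.on Hom_into.

Definition into_scale (f : End) (u : Hom_into) : Hom_into :=
  (f : {linear M -> M}) \o (u : {linear N -> M}).

Fact into_scaleA f g u : into_scale f (into_scale g u) = into_scale (f * g) u.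
Proof. exact: HomP. Qed.
Fact into_scale1 : left_id 1 into_scale.
Proof. by move=> u; apply: HomP. Qed.
Fact into_scaleDr : right_distributive into_scale +%R.
Proof.
by move=> f u v; apply: HomP => x; apply: (raddfD (f : {linear M -> M})).
Qed.
Fact into_scaleDl u : {morph into_scale^~ u : f g / f + g}.
Proof. by move=> f g; apply: HomP. Qed.

HB.instance Definition _ := GRing.Zmodule_isLmodule.Build End Hom_into
  into_scaleA into_scale1 into_scaleDr into_scaleDl.
End HomInto.

Section Gbar.
Variable X : lmodType End.

(* Hom_{End(M)}(X, M) as a left A-module, A acting on the values in M *)
Definition Gbar : Type := Hom X evmod.
HB.instance Definition _ := GRing.Zmodule.on Gbar.
Implicit Types (a b : A) (u v : Gbar).

Fact Gbar_scale_linear a u :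
  linear ((fun x => a *: (u x : M)) : X -> evmod).
Proof.
move=> f x y; have -> : u (f *: x + y) = f *: u x + u y.
  exact: (linearP (u : {linear X -> evmod})).
rewrite [LHS](scalerDr a (f (u x)) (u y : M)); congr (_ + _).
by symmetry; apply: (linearZ_LR (f : {linear M -> M})).
Qed.

Definition Gbar_scale a u : Gbar := Hom_of (Gbar_scale_linear a u).

Fact Gbar_scaleA a b u : Gbar_scale a (Gbar_scale b u) = Gbar_scale (a * b) u.
Proof. by apply: HomP => x; apply: (@scalerA A M). Qed.
Fact Gbar_scale1 : left_id 1 Gbar_scale.
Proof. by move=> u; apply: HomP => x; apply: (@scale1r A M). Qed.
Fact Gbar_scaleDr : right_distributive Gbar_scale +%R.
Proof. by move=> a u v; apply: HomP => x; apply: (@scalerDr A M). Qed.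
Fact Gbar_scaleDl u : {morph Gbar_scale^~ u : a b / a + b}.
Proof. by move=> a b; apply: HomP => x; apply: (@scalerDl A M). Qed.

HB.instance Definition _ := GRing.Zmodule_isLmodule.Build A Gbar
  Gbar_scaleA Gbar_scale1 Gbar_scaleDr Gbar_scaleDl.
End Gbar.
End Endomorphisms.

Definition trace (A : pzRingType) (M N : lmodType A) : submodule N :=
  gen_submodule (fun y => exists (f : Hom M N) (x : M), y = f x).

Definition division_ring (D : pzRingType) : Prop :=
  1 <> 0 :> D /\
  forall x : D, x <> 0 -> exists y, y * x = 1 /\ x * y = 1.

Definition artinian_ring (R : comPzRingType) : Prop :=
  forall I : nat -> submodule R^o,
    (forall n, {subset I n.+1 <= I n}) ->
    exists n, forall m, (n <= m)%N -> I m =i I n.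

(* eta is the structure map of the R-algebra A. *)
Definition artin_algebra (R : comPzRingType) (A : pzRingType)
    (eta : {rmorphism R -> A}) : Prop :=
  [/\ artinian_ring R,
      forall r a, eta r * a = a * eta r
    & exists (n : nat) (v : 'I_n -> A),
        forall a, exists c : 'I_n -> R, a = \sum_(i < n) eta (c i) * v i].

Section Systems.
Variables (A : pzRingType) (t : nat).
Implicit Types (Psi Q Theta Y : 'I_t -> lmodType A) (le : rel 'I_t).

Definition linear_order le : Prop :=
  [/\ reflexive le, antisymmetric le, transitive le & total le].

Definition strict le : rel 'I_t := fun i j => (i != j) && le i j.

Definition op_order le : rel 'I_t := fun i j => le j i.

Record proper_costratifying Psi Q le : Prop := ProperCostratifying {
  pcs_Psi_fin_gen : forall i, fin_gen (Psi i);
  pcs_Q_fin_gen : forall i, fin_gen (Q i);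
  pcs_Q_indec : forall i, indecomposable (Q i);
  pcs_order : linear_order le;
  pcs_End : forall i, division_ring (End (Psi i));
  pcs_Hom : forall i j, strict le i j -> Hom_zero_only (Psi i) (Psi j);
  pcs_exact : forall i,
    exists (Z : lmodType A) (f : Hom Z (Q i)) (g : Hom (Q i) (Psi i)),
      short_exact f g /\
      filtered (fun X => exists2 j, le j i & X = Psi j) Z;
  pcs_Ext : forall i j, Ext1_zero (Q i) (Psi j) }.

Record ext_inj_stratifying Theta Y le : Prop := ExtInjStratifying {
  eis_Theta_fin_gen : forall i, fin_gen (Theta i);
  eis_Y_fin_gen : forall i, fin_gen (Y i);
  eis_Theta_nonzero : forall i, ~ is_zero (Theta i);
  eis_Y_nonzero : forall i, ~ is_zero (Y i);
  eis_Y_indec : forall i, indecomposable (Y i);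
  eis_order : linear_order le;
  eis_Hom : forall i j, strict le j i -> Hom_zero_only (Theta i) (Theta j);
  eis_exact : forall i,
    exists (Z : lmodType A) (f : Hom (Theta i) (Y i)) (g : Hom (Y i) Z),
      short_exact f g /\
      filtered (fun X => exists2 j, strict le j i & X = Theta j) Z;
  eis_Ext : forall j, Ext1_zero (Theta j) (dsum Y) }.

Definition Pbar Q (i : 'I_t) : lmodType (End (dsum Q)) :=
  Hom_into (dsum Q) (Q i).

(* The standard End(Q)-modules with respect to the order le on the indices. *)
Definition standard Q le (i : 'I_t) : lmodType (End (dsum Q)) :=
  quotm (trace (dsum (fun j : {j : 'I_t | strict le i j} => Pbar Q (val j)))
               (Pbar Q i)).
End Systems.

(* Main.v *)
From HB Require Import structures.
From mathcomp Require Import all_boot all_algebra boolp classical_sets.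
Require Import Defs.

Set Implicit Arguments.
Unset Strict Implicit.
Unset Printing Implicit Defensive.

Import GRing.Theory.
Local Open Scope ring_scope.

(** Write E for End(Q), and K i for the intersection of the kernels of all maps
from Q i to some Q j with j < i.

Conditions on the standard E-modules translate into conditions on maps to Q. A
linear map from Hom(Q i, Q) to Q is evaluation at an element of Q i, and the
trace that is divided out in the i-th standard module consists of the maps
from Q i to Q that factor through sums of the Q j with j < i ([traceP]).
Therefore Gbar of this standard module is K i ([Gbar_standard]), and Ext^1 of
the standard module by Q vanishes iff every E-linear map from the trace to Q is
evaluation at an element of Q i ([Ext1_standardP]).

Let (Theta, Q) be an Ext-injective stratifying system, with
Z i = Q i / Theta i. There are no maps from Theta i to Q j for j < i, so
Theta i lies in K i. Conversely Z i is filtered by the Theta j with j < i, and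
since maps to Q extend along this filtration, Z i embeds into a product of the
Q j with j < i ([Filt_cogenerated]). Hence Theta i = K i, which gives
uniqueness and the second half of (b). The same kind of induction shows that
every map from Z i to Q factors through the Q j with j < i ([Filt_through])
and that Z i is reflexive for Hom(-, Q) ([Filt_reflexive]); together these
represent every linear map on the trace as an evaluation, which is the first
half of (b).

For the converse put Theta i = K i. One has to filter Q i / K i by the K j
with j < i. In the costratifying system Hom(Q j, Psi i) = 0 for j < i, and
Hom(Q i, Psi i) is one-dimensional over End(Psi i) by Fitting's lemma
([Hom_Q_Psi_one_dim]). Lift a basis of Hom(Q i, Psi k) to maps b_l from Q i to
Q k. Modulo maps through the Q j with j < k, these generate Hom(Q i, Q k)
([upto_decompose]) and are independent ([below_independent]); in other words,
the traces filter Hom(Q i, Q) with direct sums of standard modules as factors.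
The hypothesis on Ext^1 of the standard modules then extends linear maps from
each trace to the next ([evaluable_extend]) until they are evaluations on Q i.
This yields elements of Q i on which the b_l take arbitrary values in K k, so
that the common kernels of the maps from Q i to the Q j, for j <= k < i, filter
Q i / K i as required ([standard_filtration]).

Fitting's lemma and the finite generation of K i rest on the fact that an
artinian module over a commutative artinian ring is finitely generated
([dcc_fin_gen]). *)

(** * Linear maps, submodules and exact sequences *)

Section HomTheory.
Variable A : pzRingType.
Implicit Types C L M N : lmodType A.

Lemma HomD M N (f : Hom M N) x y : f (x + y) = f x + f y.
Proof. exact: (raddfD (f : {linear M -> N})). Qed.
Lemma Hom0 M N (f : Hom M N) : f 0 = 0.
Proof. exact: (raddf0 (f : {linear M -> N})). Qed.
Lemma HomN M N (f : Hom M N) x : f (- x) = - f x.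
Proof. exact: (raddfN (f : {linear M -> N})). Qed.
Lemma HomB M N (f : Hom M N) x y : f (x - y) = f x - f y.
Proof. exact: (raddfB (f : {linear M -> N})). Qed.
Lemma HomZ M N (f : Hom M N) a x : f (a *: x) = a *: f x.
Proof. exact: (linearZ_LR (f : {linear M -> N})). Qed.
Lemma Hom_sum M N (f : Hom M N) (I : finType) (F : I -> M) :
  f (\sum_i F i) = \sum_i f (F i).
Proof. exact: (raddf_sum (f : {linear M -> N})). Qed.

Lemma add_HomE M N (f g : Hom M N) x : (f + g) x = f x + g x.
Proof. by []. Qed.
Lemma opp_HomE M N (f : Hom M N) x : (- f) x = - f x.
Proof. by []. Qed.
Lemma zero_HomE M N x : (0 : Hom M N) x = 0.
Proof. by []. Qed.
Lemma sum_HomE M N (I : finType) (F : I -> Hom M N) x :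
  (\sum_i F i) x = \sum_i F i x.
Proof. by elim/big_rec2: _ => // i y1 y2 _ <-. Qed.

Lemma sum_dsumE (I J : finType) (M : I -> lmodType A) (F : J -> dsum M) i :
  (\sum_j F j) i = \sum_j F j i.
Proof. by elim/big_rec2: _ => // j y1 y2 _ <-. Qed.

Definition comp L M N (g : Hom M N) (f : Hom L M) : Hom L N :=
  (g : {linear M -> N}) \o (f : {linear L -> M}).
Definition idh M : Hom M M := idfun : {linear M -> M}.

Arguments comp : simpl never.
Arguments idh : simpl never.

Lemma compE L M N (g : Hom M N) (f : Hom L M) x : comp g f x = g (f x).
Proof. by []. Qed.
Lemma idhE M x : idh M x = x. Proof. by []. Qed.
Lemma HomofE M N (f : M -> N) (H : linear f) x : Hom_of H x = f x.
Proof. by []. Qed.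

(** The value of q at a point is forced, so that choosing values pointwise
already gives a linear map; [desc_surj] is dual. Most maps below that have no
formula come from these two lemmas. *)
Lemma lift_inj L M N (f : Hom M N) (p : Hom L N) :
  injective f -> (forall x, exists y, f y = p x) ->
  exists q : Hom L M, forall x, f (q x) = p x.
Proof.
move=> finj fp; have [q qP] := choice fp.
have ql : linear q.
  by move=> a x y; apply: finj; rewrite HomD HomZ !qP HomD HomZ.
by exists (Hom_of ql).
Qed.

Lemma desc_surj L M N (g : Hom L M) (p : Hom L N) :
  (forall y, exists x, g x = y) -> (forall x, g x = 0 -> p x = 0) ->
  exists q : Hom M N, forall x, q (g x) = p x.
Proof.
move=> gsurj gp; have [s sP] := choice gsurj.
have E x y : g x = g y -> p x = p y.
  by move=> gxy; apply/eqP; rewrite -subr_eq0 -HomB gp // HomB gxy subrr.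
have ql : linear (p \o s).
  by move=> a x y /=; rewrite -HomZ -HomD; apply: E; rewrite HomD HomZ !sP.
by exists (Hom_of ql) => x /=; apply: E; rewrite sP.
Qed.

Lemma exact0 (X Y Z : lmodType A) (f : Hom X Y) (g : Hom Y Z) x :
  short_exact f g -> g (f x) = 0.
Proof. by move=> [_ H _]; apply/H; exists x. Qed.

Lemma Hom_inj M N (f : Hom M N) :
  (forall x, f x = 0 -> x = 0) -> injective f.
Proof.
move=> H x y fxy; apply/eqP; rewrite -subr_eq0; apply/eqP; apply: H.
by rewrite HomB fxy subrr.
Qed.

Lemma Hom_inj0 M N (f : Hom M N) x : injective f -> f x = 0 -> x = 0.
Proof. by move=> H fx; apply: H; rewrite fx Hom0. Qed.

Lemma isom_bij M N (f : Hom M N) :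
  injective f -> (forall y, exists x, f x = y) -> isom M N.
Proof.
move=> finj fs; have [s sP] := choice fs.
exists f; exists s => x; last exact: sP.
by apply: finj; rewrite sP.
Qed.

Lemma isom_inv M N : isom M N ->
  exists (f : Hom M N) (g : Hom N M), cancel f g /\ cancel g f.
Proof.
move=> [f [g fK gK]].
have [h hP] := lift_inj (p := idh N) (can_inj fK)
  (fun x => ex_intro _ (g x) (gK x)).
exists f, h; split=> x; last exact: hP.
by apply: (can_inj fK); apply: hP.
Qed.

Lemma isom_sym M N : isom M N -> isom N M.
Proof. by move=> /isom_inv[f [g [fK gK]]]; exists g, f. Qed.

Lemma isom_trans L M N : isom L M -> isom M N -> isom L N.
Proof.
by move=> [f fb] [g gb]; exists (comp g f); apply: bij_comp.
Qed.

Lemma submodule_exists M (P : M -> Prop) : P 0 ->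
  (forall a x y, P x -> P y -> P (a *: x + y)) ->
  exists S : submodule M, forall x, x \in S <-> P x.
Proof.
move=> P0 PD.
have H : submod_closed (fun x => `[< P x >] : bool).
  split; first exact/asboolP.
  by move=> a x y /asboolP Px /asboolP Py; apply/asboolP/PD.
by exists (Submodule H) => x; split=> /asboolP.
Qed.

Lemma submodule_eq M (S S' : submodule M) :
  (forall x, x \in S <-> x \in S') -> S = S'.
Proof.
case: S S' => [P HP] [P' HP'] E.
have PP : P = P' by apply/funext => x; apply/idP/idP => /E.
by case: _ / PP in HP' E *; rewrite (Prop_irrelevance HP HP').
Qed.

Definition incl M (S : submodule M) : Hom (subm S) M := (val : {linear subm S -> M}).

Lemma incl_inj M (S : submodule M) : injective (incl S).
Proof. exact: val_inj. Qed.
Lemma incl_mem M (S : submodule M) (x : subm S) : incl S x \in S.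
Proof. exact: valP. Qed.
Lemma incl_onto M (S : submodule M) x : x \in S -> exists y : subm S, incl S y = x.
Proof. by move=> xS; exists (exist _ x xS). Qed.

Fact proj_linear M (S : submodule M) : linear (@quot_pi A M S).
Proof.
move=> a x y; rewrite quot_piD; congr (_ + _).
by rewrite -quot_scale_pi.
Qed.
Definition proj M (S : submodule M) : Hom M (quotm S) := Hom_of (@proj_linear M S).

Lemma proj_eq0 M (S : submodule M) x : proj S x = 0 <-> x \in S.
Proof.
rewrite -(Hom0 (proj S)); split.
  by move=> /(quot_piP S x 0); rewrite subr0.
by move=> xS; apply/(quot_piP S x 0); rewrite subr0.
Qed.
Lemma proj_onto M (S : submodule M) y : exists x, proj S x = y.
Proof. by eexists; apply: quot_pi_repr. Qed.

Lemma incl_proj_exact M (S : submodule M) : short_exact (incl S) (proj S).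
Proof.
split; [exact: incl_inj | | exact: proj_onto].
move=> y; split=> [/proj_eq0 /incl_onto //|[x <-]].
by apply/proj_eq0; apply: incl_mem.
Qed.

Lemma ker_submodule M N (f : Hom M N) :
  exists S : submodule M, forall x, x \in S <-> f x = 0.
Proof.
apply: submodule_exists => [|a x y fx fy]; first exact: Hom0.
by rewrite HomD HomZ fx fy scaler0 addr0.
Qed.

Lemma im_submodule M N (f : Hom M N) :
  exists S : submodule N, forall x, x \in S <-> exists y, f y = x.
Proof.
apply: submodule_exists => [|a x y [u <-] [v <-]]; first by exists 0; apply: Hom0.
by exists (a *: u + v); rewrite HomD HomZ.
Qed.

Lemma ker_exact M N (f : Hom M N) : (forall y, exists x, f x = y) ->
  exists (K : lmodType A) (k : Hom K M), short_exact k f.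
Proof.
move=> fs; have [S SP] := ker_submodule f.
exists (subm S), (incl S); split=> //; first exact: incl_inj.
move=> y; split=> [/SP/incl_onto //|[x <-]].
by apply/SP; apply: incl_mem.
Qed.

Fact pairh_linear L M N (f : Hom L M) (g : Hom L N) :
  linear (fun x => (f x, g x) : M * N).
Proof. by move=> a x y; rewrite !HomD !HomZ. Qed.
Definition pairh L M N (f : Hom L M) (g : Hom L N) : Hom L (M * N)%type :=
  Hom_of (pairh_linear f g).
Definition fsth M N : Hom (M * N)%type M := (fst : {linear _ -> _}).
Definition sndh M N : Hom (M * N)%type N := (snd : {linear _ -> _}).

(** The pushout of f and w, as the quotient of N * Y by the pairs
(w x, - f x). Through its last two clauses it also serves as a third
isomorphism theorem: when w is onto, so is w', with kernel f (ker w). *)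
Lemma pushout (X Y Z N : lmodType A) (f : Hom X Y) (g : Hom Y Z) (w : Hom X N) :
  short_exact f g ->
  exists (Y' : lmodType A) (f' : Hom N Y') (g' : Hom Y' Z) (w' : Hom Y Y'),
  [/\ short_exact f' g', forall x, w' (f x) = f' (w x),
      forall y, g' (w' y) = g y,
      forall y, w' y = 0 -> exists x, f x = y /\ w x = 0 &
      forall y', exists n y, y' = f' n + w' y].
Proof.
move=> [finj fg gs].
have [S SP] := im_submodule (pairh w (- f)).
have [g' g'P] : exists g' : Hom (quotm S) Z,
    forall p, g' (proj S p) = comp g (@sndh N Y) p.
  apply: desc_surj => [|_ /proj_eq0/SP[x <-]]; first exact: proj_onto.
  by rewrite /= HomN; apply/eqP; rewrite oppr_eq0; apply/eqP/fg; exists x.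
exists (quotm S : lmodType A), (comp (proj S) (pairh (idh N) 0)), g'.
exists (comp (proj S) (pairh 0 (idh Y))).
have E n : pairh (idh N) (0 : Hom N Y) n = (n, 0) by [].
have E2 n : pairh (0 : Hom Y N) (idh Y) n = (0, n) by [].
have E0 x : pairh w (- f) x = (w x, - f x) by [].
split.
- split.
  + apply: Hom_inj => n; rewrite compE => /proj_eq0/SP[x]; rewrite E E0 => -[<- /eqP].
    by rewrite oppr_eq0 => /eqP/(Hom_inj0 finj) ->; rewrite Hom0.
  + move=> y; split.
      have [[n y'] <-] := proj_onto y; rewrite g'P => /fg[x fx].
      have {}fx : f x = y' by [].
      exists (n + w x); rewrite compE E; apply/eqP; rewrite -subr_eq0 -HomB.
      apply/eqP/proj_eq0/SP; exists x; rewrite E0; apply/eqP.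
      rewrite -[X in _ == X]/(n + w x - n, 0 - y') -fx sub0r addrAC subrr add0r.
      by [].
    by move=> [n <-]; rewrite compE g'P /= Hom0.
  + by move=> z; have [y gy] := gs z; exists (proj S (0, y)); rewrite g'P.
- move=> x; rewrite !compE; apply/eqP; rewrite -subr_eq0 -HomB.
  apply/eqP/proj_eq0/SP; exists (- x); rewrite E E2 E0 !HomN opprK.
  by rewrite -[RHS]/(0 - w x, f x - 0) sub0r subr0.
- by move=> y; rewrite compE g'P.
- move=> y; rewrite compE => /proj_eq0/SP[x]; rewrite E0 E2 => -[wx fx].
  by exists (- x); rewrite !HomN wx oppr0.
- move=> y'; have [[n y] <-] := proj_onto y'; exists n, y.
  by rewrite !compE -HomD E E2 -[_ + (_, _)]/(n + 0, 0 + y) addr0 add0r.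
Qed.

(** The pullback of g and w, as a submodule of Y * W. When w is injective it is
the preimage under g of the submodule W of Z. *)
Lemma pullback (X Y Z W : lmodType A) (f : Hom X Y) (g : Hom Y Z) (w : Hom W Z) :
  short_exact f g ->
  exists (Y' : lmodType A) (f' : Hom X Y') (g' : Hom Y' W) (w' : Hom Y' Y),
  [/\ short_exact f' g', forall x, w' (f' x) = f x,
      forall y, g (w' y) = w (g' y),
      forall y, w' y = 0 -> g' y = 0 -> y = 0 &
      forall y v, g y = w v -> exists y', w' y' = y /\ g' y' = v].
Proof.
move=> [finj fg gs].
have [S SP] := ker_submodule (comp g (@fsth Y W) - comp w (@sndh Y W)).
have [f' f'P] := @lift_inj _ _ _ (incl S) (pairh f 0) (@incl_inj _ S) (fun x =>
   ltac:(apply: incl_onto; apply/SP; rewrite /= Hom0 subr0; apply/fg; by exists x)).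
exists (subm S : lmodType A), f', (comp (@sndh Y W) (incl S)).
exists (comp (@fsth Y W) (incl S)).
have E1 p : @fsth Y W p = p.1 by [].
have E2 p : @sndh Y W p = p.2 by [].
have E3 p : pairh f (0 : Hom X W) p = (f p, 0) by [].
have DE p : (comp g (@fsth Y W) - comp w (@sndh Y W)) p = g p.1 - w p.2 by [].
have SE (y : subm S) : g (incl S y).1 = w (incl S y).2.
  by apply/eqP; rewrite -subr_eq0; apply/eqP; apply/SP; apply: incl_mem.
split.
- split.
  + move=> x y /(congr1 (incl S)); rewrite !f'P !E3 => -[]; exact: finj.
  + move=> y; rewrite compE E2; split=> [y0|[x <-]]; last by rewrite f'P.
    have := SE y; rewrite y0 Hom0 => /fg[x fx]; exists x.
    apply: incl_inj; rewrite f'P E3 fx.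
    by case: (incl S y) y0 => a b /= ->.
  + move=> v; have [y gy] := gs (w v).
    have [|p pE] := @incl_onto _ S (y, v); last by exists p; rewrite compE pE.
    by apply/SP; rewrite DE [X in X - _]gy subrr.
- by move=> x; rewrite compE f'P.
- by move=> y; rewrite !compE SE.
- move=> y; rewrite !compE E1 E2 => y1 y2; apply: incl_inj; rewrite Hom0.
  by case: (incl S y) y1 y2 => a b /= -> ->.
- move=> y v gy; have [|p pE] := @incl_onto _ S (y, v).
    by apply/SP; rewrite DE [X in X - _]gy subrr.
  by exists p; rewrite !compE pE.
Qed.

(** The form that [Ext1_zero C N] takes in the long exact sequence of
Hom(C, -), for sequences that start at N. [extends] is the form that it takes
in the long exact sequence of Hom(-, N), for sequences that end at C. *)
Definition lifts C N := forall (B D : lmodType A) (f : Hom N B) (g : Hom B D)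
  (p : Hom C D), short_exact f g -> exists q : Hom C B, forall x, g (q x) = p x.
Definition extends C N := forall (X Y : lmodType A) (f : Hom X Y) (g : Hom Y C)
  (p : Hom X N), short_exact f g -> exists q : Hom Y N, forall x, q (f x) = p x.

(** The pullback of the given sequence along p splits. A splitting is a
retraction r onto N, and the kernel of r maps isomorphically onto C. *)
Lemma Ext1_lifts C N : Ext1_zero C N -> lifts C N.
Proof.
move=> H B D f g p fg; have [Y [f' [g' [w [E _ gw _ _]]]]] := pullback p fg.
have [phi [phi1 phi2]] := H (Extension E).
pose r : Hom Y N := comp (@fsth N C) phi.
have rf n : r (f' n) = n by rewrite /r compE [phi (f' _)]phi1.
have [_ Ek Es] := E.
have phis c : exists y, g' y = c /\ r y = 0.
  have [y gy] := Es c.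
  by exists (y - f' (r y)); rewrite !HomB rf gy (exact0 _ E) subr0 subrr.
have [s sP] := choice phis.
have rinj y : g' y = 0 -> r y = 0 -> y = 0.
  by move=> /Ek[n <-]; rewrite rf => ->; rewrite Hom0.
have sl : linear s.
  move=> a x y; apply/eqP; rewrite -subr_eq0; apply/eqP; apply: rinj.
    by rewrite HomB HomD HomZ (sP _).1 (sP x).1 (sP y).1 subrr.
  rewrite HomB HomD HomZ (sP _).2 (sP x).2 (sP y).2.
  by rewrite scaler0 addr0 subrr.
exists (comp w (Hom_of sl)) => x; rewrite compE gw HomofE.
by rewrite (sP x).1.
Qed.

Lemma extends_Ext1 C N : extends C N -> Ext1_zero C N.
Proof.
move=> H [B f g fg]; have [r rP] := H _ _ f g (idh N) fg.
exists (pairh r g); split=> y; last by [].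
by rewrite -[LHS]/(_, _) rP (exact0 _ fg).
Qed.

(** Lifting the identity of C gives a section s, and b - s (g b) is the
N-component of b. *)
Lemma lifts_Ext1 C N : lifts C N -> Ext1_zero C N.
Proof.
move=> H [B f g fg]; have [s sP] := H _ _ f g (idh C) fg.
have [r rP] : exists r : Hom B N, forall b, f (r b) = (idh B - comp s g) b.
  have [finj fE _] := fg; apply: lift_inj => // b; apply/fE.
  by rewrite HomB compE sP subrr.
have [finj _ _] := fg.
exists (pairh r g); split=> y; last by [].
rewrite -[LHS]/(_, _) (exact0 _ fg); congr (_, _); apply: finj.
by rewrite rP add_HomE opp_HomE compE (exact0 _ fg) Hom0 subr0.
Qed.

(** The pushout of the given sequence along p splits. *)
Lemma Ext1_extends C N : Ext1_zero C N -> extends C N.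
Proof.
move=> H X Y f g p fg; have [Y' [f' [g' [w [E fw gw _ _]]]]] := pushout p fg.
have [phi [phi1 phi2]] := H (Extension E).
exists (comp (@fsth N C) (comp phi w)) => x; rewrite !compE fw.
by rewrite [phi (f' _)]phi1.
Qed.

Lemma Ext1_zero_isom C (C' : lmodType A) N :
  isom C C' -> Ext1_zero C N -> Ext1_zero C' N.
Proof.
move=> /isom_inv[u [v [uK vK]]] /Ext1_lifts H; apply: lifts_Ext1.
move=> B D f g p fg; have [q qP] := H _ _ f g (comp p u) fg.
by exists (comp q v) => x; rewrite compE qP compE vK.
Qed.

(** A map from C into the last term of a sequence starting at N lifts first to
the middle term modulo N1, which is an extension by N2, and then along the
sequence that N1 starts. *)
Lemma Ext1_zero_ext_r C (N1 N N2 : lmodType A) (f : Hom N1 N) (g : Hom N N2) :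
  short_exact f g -> Ext1_zero C N1 -> Ext1_zero C N2 -> Ext1_zero C N.
Proof.
move=> fg /Ext1_lifts H1 /Ext1_lifts H2; apply: lifts_Ext1.
move=> B D i p c ip.
have [B' [i' [p' [w [E iw pw w0 ws]]]]] := pushout g ip.
have [q qP] := H2 _ _ i' p' c E.
have fgw : short_exact (comp i f) w.
  case: fg => finj fg gs; case: ip => iinj ip ps; split.
  - by move=> x y; rewrite !compE => /iinj/finj.
  - move=> y; split=> [/w0[x [<- /fg[z <-]]]|[x <-]]; first by exists z.
    by rewrite compE iw (fg _).2 ?Hom0 //; exists x.
  - move=> z; have [n [y ->]] := ws z; have [m <-] := gs n.
    by exists (i m + y); rewrite HomD iw.
have [r rP] := H1 _ _ _ w q fgw.
by exists r => x; rewrite -pw rP qP.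
Qed.

(** A map defined on the first term of a sequence ending at C extends first to
the preimage of C1, and then along the sequence that ends at C2. *)
Lemma Ext1_zero_ext_l (C1 C C2 : lmodType A) N (f : Hom C1 C) (g : Hom C C2) :
  short_exact f g -> Ext1_zero C1 N -> Ext1_zero C2 N -> Ext1_zero C N.
Proof.
move=> fg /Ext1_extends H1 /Ext1_extends H2; apply: extends_Ext1.
move=> X Y i p c ip.
have [Y' [i' [p' [w [E wi pw w0 ws]]]]] := pullback f ip.
have [q qP] := H1 _ _ i' p' c E.
have wgp : short_exact w (comp g p).
  case: fg => finj fg gs; case: (ip) => iinj ip' ps; split.
  - apply: Hom_inj => y wy; apply: w0 => //; apply: finj.
    by rewrite -pw wy !Hom0.
  - move=> y; rewrite compE; split=> [/fg[v fv]|[y' <-]].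
      by have [y' [<- _]] := ws y v (esym fv); exists y'.
    by rewrite pw; apply/fg; exists (p' y').
  - move=> z; have [c' <-] := gs z; have [y <-] := ps c'; by exists y.
have [r rP] := H2 _ _ w _ q wgp.
by exists r => x; rewrite -wi rP qP.
Qed.

Lemma Ext1_zero_is_zero_l C N : is_zero C -> Ext1_zero C N.
Proof.
move=> C0; apply: lifts_Ext1 => B D f g p _; exists 0 => x.
by rewrite (C0 x) !Hom0.
Qed.
Lemma Ext1_zero_is_zero_r C N : is_zero N -> Ext1_zero C N.
Proof.
move=> N0; apply: extends_Ext1 => B D f g p _; exists 0 => x.
by rewrite (N0 (p x)).
Qed.
End HomTheory.

(** * Modules with a filtration *)

Section FiltTheory.
Variable A : pzRingType.
Implicit Types (M N X Y : lmodType A) (C : lmodType A -> Prop).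

(** An inductive form of [filtered]: removing the top factor of a filtration
becomes an induction step. *)
Inductive Filt C : lmodType A -> Prop :=
| Filt_zero X : is_zero X -> Filt C X
| Filt_step X1 X Y (f : Hom X1 X) (g : Hom X Y) :
    short_exact f g -> Filt C X1 -> C Y -> Filt C X.

Lemma Filt_sub C C' X : (forall Y, C Y -> C' Y) -> Filt C X -> Filt C' X.
Proof.
move=> CC'; elim=> [Z Z0|X1 Z Y f g fg _ IH CY]; first exact: Filt_zero.
exact: Filt_step fg IH (CC' _ CY).
Qed.

Lemma exact_isom_mid X Y (Z Y' : lmodType A) (f : Hom X Y) (g : Hom Y Z)
    (u : Hom Y Y') (v : Hom Y' Y) : cancel u v -> cancel v u ->
  short_exact f g -> short_exact (comp u f) (comp g v).
Proof.
move=> uK vK [finj fg gs]; split.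
- by move=> x y; rewrite !compE => /(can_inj uK)/finj.
- move=> y; rewrite compE; split=> [/fg[x fx]|[x <-]].
    by exists x; rewrite compE fx vK.
  by rewrite compE uK; apply/fg; exists x.
- by move=> z; have [y <-] := gs z; exists (u y); rewrite compE uK.
Qed.

Lemma exact_isom_right X Y (Z Z' : lmodType A) (f : Hom X Y) (g : Hom Y Z)
    (u : Hom Z Z') : bijective u ->
  short_exact f g -> short_exact f (comp u g).
Proof.
move=> [v uK vK] [finj fg gs]; split=> //.
- move=> y; rewrite compE; split=> [uy|/fg ->]; last exact: Hom0.
  by apply/fg; apply: (Hom_inj0 (can_inj uK)).
- by move=> z; have [y gy] := gs (v z); exists y; rewrite compE gy vK.
Qed.

Lemma Filt_isom C X Y : isom X Y -> Filt C X -> Filt C Y.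
Proof.
move=> /isom_inv[u [v [uK vK]]] FX.
case: FX u v uK vK => [Z Z0|X1 Z W f g fg F1 CW] u v uK vK.
  by apply: Filt_zero => y; rewrite -[y]vK (Z0 (v y)) Hom0.
exact: Filt_step (exact_isom_mid uK vK fg) F1 CW.
Qed.

Lemma Filt_class C X : C X -> Filt C X.
Proof.
move=> CX.
have [K [k kE]] := ker_exact (f := idh X) (fun y => ex_intro _ y (idhE y)).
apply: Filt_step (kE) _ CX; apply: Filt_zero => x.
by have [kinj _ _] := kE; apply: (Hom_inj0 kinj); apply: (exact0 x kE).
Qed.

(** Remove the top factors of Z one at a time, each time replacing Y by the
preimage of what is left of Z. *)
Lemma Filt_ext C X Y (Z : lmodType A) (f : Hom X Y) (g : Hom Y Z) :
  short_exact f g -> Filt C X -> Filt C Z -> Filt C Y.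
Proof.
move=> fg FX FZ; elim: FZ Y f g fg => [W W0|Z1 W V h k hk F1 IH CV] Y f g fg.
  apply: Filt_isom FX; have [finj fE _] := fg.
  by apply: (isom_bij finj) => y; apply/fE; apply: W0.
have [Y' [f' [g' [w [E wf gw w0 ws]]]]] := pullback h fg.
have F' := IH _ _ _ E.
have [hinj hE hs] := hk; have [finj fE gs] := fg.
suff wE : short_exact w (comp k g) by apply: Filt_step wE F' CV.
split.
- apply: Hom_inj => y wy; apply: w0 => //; apply: hinj.
  by rewrite -gw wy !Hom0.
- move=> y; rewrite compE; split=> [/hE[z hz]|[y' <-]].
    by have [y' [<- _]] := ws y z (esym hz); exists y'.
  by rewrite gw; apply/hE; exists (g' y').
- move=> z; have [x <-] := hs z; have [y <-] := gs x.
  by exists y.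
Qed.

Lemma Filt_Ext_r C X N : (forall Y, C Y -> Ext1_zero N Y) -> Filt C X ->
  Ext1_zero N X.
Proof.
move=> CE; elim=> [Z Z0|X1 Z Y f g fg _ IH CY]; first exact: Ext1_zero_is_zero_r.
exact: Ext1_zero_ext_r fg IH (CE _ CY).
Qed.

Lemma Filt_Ext_l C X N : (forall Y, C Y -> Ext1_zero Y N) -> Filt C X ->
  Ext1_zero X N.
Proof.
move=> CE; elim=> [Z Z0|X1 Z Y f g fg _ IH CY]; first exact: Ext1_zero_is_zero_l.
exact: Ext1_zero_ext_l fg IH (CE _ CY).
Qed.

Lemma Hom0_ext_r N X Y (Z : lmodType A) (f : Hom X Y) (g : Hom Y Z) :
  short_exact f g -> Hom_zero_only N X -> Hom_zero_only N Z ->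
  Hom_zero_only N Y.
Proof.
move=> [finj fE _] HX HZ h.
have [q qP] : exists q : Hom N X, forall x, f (q x) = h x.
  apply: lift_inj => // x; apply/fE.
  by rewrite -compE (HZ (comp g h)).
by apply: HomP => x; rewrite -qP (HX q) Hom0.
Qed.

Lemma Hom0_ext_l N X Y (Z : lmodType A) (f : Hom X Y) (g : Hom Y Z) :
  short_exact f g -> Hom_zero_only X N -> Hom_zero_only Z N ->
  Hom_zero_only Y N.
Proof.
move=> [finj fE gs] HX HZ h.
have [q qP] : exists q : Hom Z N, forall x, q (g x) = h x.
  apply: desc_surj => // x /fE[y <-].
  by rewrite -compE (HX (comp h f)).
by apply: HomP => x; rewrite -qP (HZ q).
Qed.

Lemma is_zero_Hom_r N X : is_zero X -> Hom_zero_only N X.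
Proof. by move=> X0 f; apply: HomP => x; apply: X0. Qed.
Lemma is_zero_Hom_l N X : is_zero X -> Hom_zero_only X N.
Proof. by move=> X0 f; apply: HomP => x; rewrite (X0 x) !Hom0. Qed.

Lemma Filt_Hom0_r C X N : (forall Y, C Y -> Hom_zero_only N Y) -> Filt C X ->
  Hom_zero_only N X.
Proof.
move=> CE; elim=> [Z Z0|X1 Z Y f g fg _ IH CY]; first exact: is_zero_Hom_r.
exact: Hom0_ext_r fg IH (CE _ CY).
Qed.

Lemma Filt_Hom0_l C X N : (forall Y, C Y -> Hom_zero_only Y N) -> Filt C X ->
  Hom_zero_only X N.
Proof.
move=> CE; elim=> [Z Z0|X1 Z Y f g fg _ IH CY]; first exact: is_zero_Hom_l.
exact: Hom0_ext_l fg IH (CE _ CY).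
Qed.

(** Describes a factor of two submodules by a map that is defined on the larger
one, which avoids any computation in iterated quotients. *)
Lemma factor_isomP M (U V : submodule M) Y :
  isom (factor U V) Y <->
  exists h : Hom (subm V) Y, (forall y, exists x, h x = y) /\
    forall x, h x = 0 <-> incl V x \in U.
Proof.
pose W : submodule (subm V) := Submodule (factor_pred_closed U V).
have WE (x : subm V) : (x \in W) = (incl V x \in U) by [].
split=> [[u [v uK vK]]|[h [hs h0]]].
  exists (comp (u : Hom (quotm W) Y) (proj W)); split.
    by move=> y; have [x xP] := proj_onto (v y : quotm W);
       exists x; rewrite compE xP; apply: vK.
  move=> x; rewrite -WE compE; split=> [ux|/proj_eq0 ->]; last exact: Hom0.
  by apply/proj_eq0; apply: (Hom_inj0 (can_inj uK)).
have [q qP] : exists q : Hom (quotm W) Y, forall x, q (proj W x) = h x.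
  apply: desc_surj; first exact: proj_onto.
  by move=> x /proj_eq0; rewrite WE => /h0.
apply: (isom_bij (f := q)) => [|y]; last first.
  by have [x <-] := hs y; exists (proj W x).
apply: Hom_inj => w; have [x <-] := proj_onto w.
by rewrite qP => /h0 xU; apply/proj_eq0.
Qed.

Lemma filtered_Filt C M : filtered C M -> Filt C M.
Proof.
move=> [n [F [F0 Fn Fs]]].
have H i : (i <= n)%N -> Filt C (subm (F i)).
  elim: i => [_|i IH lt_in].
    apply: Filt_zero => x; apply: incl_inj; rewrite Hom0.
    by apply/F0; apply: incl_mem.
  have [sF [X CX /factor_isomP[h [hs h0]]]] := Fs i lt_in.
  have [f fP] : exists f : Hom (subm (F i)) (subm (F i.+1)),
      forall x, incl _ (f x) = incl _ x.
    apply: lift_inj => [|x]; first exact: incl_inj.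
    by apply/incl_onto/sF/incl_mem.
  apply: (@Filt_step _ _ _ _ f h _ (IH (ltnW lt_in)) CX).
  split=> //.
    by move=> x y /(congr1 (incl _)); rewrite !fP => /incl_inj.
  move=> y; rewrite h0; split=> [/incl_onto[x xy]|[x <-]].
    by exists x; apply: incl_inj; rewrite fP.
  by rewrite fP; apply: incl_mem.
apply: Filt_isom (H n (leqnn n)).
apply: (isom_bij (f := incl (F n))) => [|y]; first exact: incl_inj.
by apply: incl_onto; apply: Fn.
Qed.

(** The images under f of the submodules that filter X1, followed by all of X. *)
Lemma Filt_filtered C M : Filt C M -> filtered C M.
Proof.
elim=> [X X0|X1 X Y f g fg _ [n [F [F0 Fn Fs]]] CY].
  have [S SP] := @submodule_exists A X (fun _ => True) I (fun _ _ _ _ _ => I).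
  exists 0%N, (fun _ => S); split=> // x; last exact/SP.
  by split=> // _; apply/SP.
have imF i : exists G : submodule X, forall x,
    x \in G <-> exists2 y, y \in F i & f y = x.
  apply: submodule_exists => [|a x y [u uF <-] [v vF <-]].
    by exists 0; rewrite ?rpred0 ?Hom0.
  by exists (a *: u + v); rewrite ?rpredD ?rpredZ // HomD HomZ.
have [G GP] := choice imF.
have [T TP] := @submodule_exists A X (fun _ => True) I (fun _ _ _ _ _ => I).
have [finj fE gs] := fg.
exists n.+1, (fun i => if (i <= n)%N then G i else T); split.
- move=> x; rewrite leq0n; split=> [/GP[y /F0 -> <-]|->]; first exact: Hom0.
  exact: rpred0.
- by move=> x; rewrite ltnn; apply/TP.
move=> i le_in; have /orP[/eqP -> |lt_in] : (i == n) || (i < n)%N.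
  by rewrite -leq_eqVlt.
  cbv beta; rewrite leqnn ltnn; split=> [x _|]; first exact/TP.
  exists Y => //; apply/factor_isomP; exists (comp g (incl T)); split.
    move=> y; have [x <-] := gs y.
    by have [|z <-] := @incl_onto _ _ T x; [exact/TP|exists z].
  move=> x; rewrite compE GP; split=> [/fE[y <-]|[y _ <-]]; first by exists y.
  by apply/fE; exists y.
cbv beta; rewrite lt_in ltnW //.
have [sF [Z CZ /factor_isomP[h [hs h0]]]] := Fs i lt_in.
split=> [x /GP[y /sF yF <-]|]; first by apply/GP; exists y.
exists Z => //; apply/factor_isomP.
have [q qP] : exists q : Hom (subm (G i.+1)) X1, forall x, f (q x) = incl _ x.
  by apply: lift_inj => // x; have /GP[y _ <-] := incl_mem x; exists y.
have qF x : q x \in F i.+1.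
  by have /GP[y yF] := incl_mem x; rewrite -qP => /finj <-.
have [r rP] : exists r : Hom (subm (G i.+1)) (subm (F i.+1)),
   forall x, incl _ (r x) = q x.
  by apply: lift_inj => [|x]; [exact: incl_inj|apply: incl_onto].
exists (comp h r); split=> [z|x]; rewrite ?compE.
  have [y <-] := hs z.
  have /incl_onto[x xP] : f (incl _ y) \in G i.+1.
    by apply/GP; exists (incl _ y); rewrite ?incl_mem.
  exists x; rewrite compE; congr (h _); apply: incl_inj; apply: finj.
  by rewrite rP qP.
rewrite h0 rP GP -qP; split=> [qx|[y yF /finj <-]] //.
by exists (q x).
Qed.

(** The image of L in the quotient by L' is isomorphic to Y. *)
Lemma Filt_quot_step C X Y (L L' : submodule X) (g : Hom (subm L) Y) :
  (forall y, exists x, g x = y) -> (forall x, g x = 0 <-> incl L x \in L') ->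
  {subset L' <= L} -> Filt C Y -> Filt C (quotm L) -> Filt C (quotm L').
Proof.
move=> gs gE LL' FY FL.
have [u uP] : exists u : Hom Y (quotm L'), forall x, u (g x) = proj L' (incl L x).
  by apply: (desc_surj (g := g) (p := comp (proj L') (incl L))) => // x /gE/proj_eq0.
have [v vP] : exists v : Hom (quotm L') (quotm L),
    forall x, v (proj L' x) = proj L x.
  apply: (desc_surj (g := proj L') (p := proj L)) => [|x /proj_eq0 xL].
    exact: proj_onto.
  exact/proj_eq0/LL'.
apply: (Filt_ext (f := u) (g := v)) FY FL; split.
- apply: Hom_inj => y; have [x <-] := gs y.
  by rewrite uP => /proj_eq0/gE.
- move=> z; have [x <-] := proj_onto z; rewrite vP.
  split=> [/proj_eq0/incl_onto[y <-]|[y]].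
    by exists (g y); rewrite uP.
  have [x' <-] := gs y; rewrite uP => E.
  rewrite -vP -E vP; apply/proj_eq0; exact: incl_mem.
- move=> z; have [x <-] := proj_onto z; by exists (proj L' x).
Qed.

End FiltTheory.

(** * Maps that factor through a family of modules *)

Section Through.
Variables (A : pzRingType) (t : nat) (Q : 'I_t -> lmodType A).
Implicit Types (M N : lmodType A) (J : 'I_t -> Prop).

(** The trace in Hom(M, N) of the modules Q j with J j. As an inductive
predicate it leaves the number of summands free. *)
Inductive through J M N : Hom M N -> Prop :=
| through0 : through J 0
| throughD j (a : Hom M (Q j)) (b : Hom (Q j) N) h :
    J j -> through J h -> through J (h + comp b a).

Lemma through_comp J M N j (a : Hom M (Q j)) (b : Hom (Q j) N) :
  J j -> through J (comp b a).
Proof.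
by move=> Jj; rewrite -[comp b a]add0r; apply: throughD => //; exact: through0.
Qed.

Lemma through_add J M N (g h : Hom M N) :
  through J g -> through J h -> through J (g + h).
Proof.
move=> Hg; elim=> [|j a b h' Jj Hh' IH]; first by rewrite addr0.
by rewrite addrA; apply: throughD.
Qed.

Lemma through_post J M N N' (u : Hom N N') (h : Hom M N) :
  through J h -> through J (comp u h).
Proof.
elim=> [|j a b h' Jj Hh' IH].
  have -> : comp u (0 : Hom M N) = 0 by apply: HomP => x; rewrite compE Hom0.
  exact: through0.
have -> : comp u (h' + comp b a) = comp u h' + comp (comp u b) a.
  by apply: HomP => x; rewrite compE HomD.
exact: throughD.
Qed.

Lemma through_pre J M M' N (u : Hom M' M) (h : Hom M N) :
  through J h -> through J (comp h u).
Proof.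
elim=> [|j a b h' Jj Hh' IH].
  have -> : comp (0 : Hom M N) u = 0 by apply: HomP => x; rewrite compE.
  exact: through0.
have -> : comp (h' + comp b a) u = comp h' u + comp b (comp a u).
  by apply: HomP => x.
exact: throughD.
Qed.

Lemma through_opp J M N (h : Hom M N) : through J h -> through J (- h).
Proof.
have -> : - h = comp (- idh N) h by apply: HomP => x.
exact: through_post.
Qed.

Lemma through_sum J M N (I : finType) (F : I -> Hom M N) :
  (forall i, through J (F i)) -> through J (\sum_i F i).
Proof.
move=> H; elim/big_rec: _ => [|i h _ Hh]; first exact: through0.
exact: through_add.
Qed.

Lemma through_mono J J' M N (h : Hom M N) :
  (forall j, J j -> J' j) -> through J h -> through J' h.
Proof.
move=> JJ'; elim=> [|j a b h' Jj Hh' IH]; first exact: through0.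
by apply: throughD => //; apply: JJ'.
Qed.

Lemma through_Hom0 J M N N' (u : Hom N N') (h : Hom M N) :
  (forall j, J j -> Hom_zero_only (Q j) N') -> through J h -> comp u h = 0.
Proof.
move=> JN; elim=> [|j a b h' Jj Hh' IH]; apply: HomP => x.
  by rewrite compE Hom0.
rewrite compE HomD -[u (h' x)]compE IH zero_HomE add0r.
by rewrite -[LHS]/(comp u b (a x)) (JN j Jj (comp u b)).
Qed.

Lemma through_kill J M N (h : Hom M N) x :
  (forall j (a : Hom M (Q j)), J j -> a x = 0) -> through J h -> h x = 0.
Proof.
move=> H; elim=> [|j a b h' Jj Hh' IH] //.
by rewrite add_HomE IH compE H // Hom0 addr0.
Qed.
End Through.

(** * Finite generation and chain conditions *)

Section FinGen.
Variable A : pzRingType.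
Implicit Types (M N X Y : lmodType A).

Lemma fin_gen_finType M (I : finType) (v : I -> M) :
  (forall x, exists c : I -> A, x = \sum_i c i *: v i) -> fin_gen M.
Proof.
move=> H; exists #|I|, (v \o enum_val) => x; have [c ->] := H x.
exists (c \o enum_val); rewrite (reindex (@enum_val I I)) //=.
exact/onW_bij/enum_val_bij.
Qed.

Lemma fin_gen_surj M N (f : Hom M N) :
  (forall y, exists x, f x = y) -> fin_gen M -> fin_gen N.
Proof.
move=> fs [n [v vP]]; exists n, (f \o v) => y.
have [x <-] := fs y; have [c ->] := vP x.
by exists c; rewrite Hom_sum; apply: eq_bigr => i _; rewrite HomZ.
Qed.

Lemma fin_gen_ext X M Y (f : Hom X M) (g : Hom M Y) :
  (forall y, g y = 0 -> exists x, f x = y) -> (forall z, exists y, g y = z) ->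
  fin_gen X -> fin_gen Y -> fin_gen M.
Proof.
move=> fg gs [m [v vP]] [n [w wP]].
have [u uP] := choice (fun i => gs (w i)).
apply: (@fin_gen_finType _ ('I_m + 'I_n)%type
  (fun k => match k with inl i => f (v i) | inr j => u j end)) => x.
have [c cP] := wP (g x).
have [|z zP] := fg (x - \sum_j c j *: u j).
  rewrite HomB Hom_sum cP; apply/eqP; rewrite subr_eq0; apply/eqP.
  by apply: eq_bigr => j _; rewrite HomZ uP.
have [d dP] := vP z.
exists (fun k => match k with inl i => d i | inr j => c j end).
rewrite big_sumType /=; apply/eqP; rewrite -subr_eq -zP dP Hom_sum.
by apply/eqP/eq_bigr => i _; rewrite HomZ.
Qed.

Definition dcc M : Prop := forall I : nat -> submodule M,
  (forall n, {subset I n.+1 <= I n}) ->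
  exists n, forall m, (n <= m)%N -> I m =i I n.

Lemma preim_submodule M N (f : Hom M N) (S : submodule N) :
  exists S' : submodule M, forall x, x \in S' <-> f x \in S.
Proof.
apply: submodule_exists => [|a x y fx fy]; first by rewrite Hom0 rpred0.
by rewrite HomD HomZ rpredD ?rpredZ.
Qed.

Lemma image_submodule M N (f : Hom M N) (S : submodule M) :
  exists S' : submodule N, forall y, y \in S' <-> exists2 x, x \in S & f x = y.
Proof.
apply: submodule_exists => [|a x y [u uF <-] [v vF <-]].
  by exists 0; rewrite ?rpred0 ?Hom0.
by exists (a *: u + v); rewrite ?rpredD ?rpredZ // HomD HomZ.
Qed.

Lemma full_submodule M : exists S : submodule M, forall x, x \in S.
Proof.
have [S SP] := @submodule_exists A M (fun _ => True) I (fun _ _ _ _ _ => I).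
by exists S => x; apply/SP.
Qed.

Lemma chain_sub M (I : nat -> submodule M) :
  (forall n, {subset I n.+1 <= I n}) ->
  forall n m, (n <= m)%N -> {subset I m <= I n}.
Proof.
move=> IS n m /subnK <-; elim: (m - n)%N => // k IH x.
by rewrite addSn => /IS/IH.
Qed.

(** A chain in M is determined by its preimages in X and its images in Y once
both have become stationary. *)
Lemma dcc_ext X M Y (f : Hom X M) (g : Hom M Y) :
  (forall y, g y = 0 -> exists x, f x = y) -> dcc X -> dcc Y -> dcc M.
Proof.
move=> fg dX dY I IS.
have [F FP] := choice (fun n => preim_submodule f (I n)).
have [G GP] := choice (fun n => image_submodule g (I n)).
have [n1 n1P] := dX F (fun n x => ltac:(by move=> /FP/IS/FP)).
have [n2 n2P] := dY G (fun n x =>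
  ltac:(by move=> /GP[y /IS yI <-]; apply/GP; exists y)).
exists (maxn n1 n2) => m; rewrite geq_max => /andP[m1 m2] x.
apply/idP/idP; first by apply: chain_sub; rewrite // geq_max m1.
move=> xI.
have : g x \in G m.
  rewrite n2P // -(n2P (maxn n1 n2)) ?leq_maxr //; apply/GP; by exists x.
move=> /GP[y yI gy]; have [|z zP] := fg (x - y); first by rewrite HomB gy subrr.
have : z \in F m.
  rewrite n1P // -(n1P (maxn n1 n2)) ?leq_maxl //; apply/FP; rewrite zP.
  rewrite rpredB //; apply: chain_sub yI => //; by rewrite geq_max m1.
by move=> /FP; rewrite zP => xy; rewrite -(subrK y x) rpredD.
Qed.

Lemma dcc_inj M N (f : Hom N M) : injective f -> dcc M -> dcc N.
Proof.
move=> finj dM I IS; have [F FP] := choice (fun n => image_submodule f (I n)).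
have [n nP] := dM F (fun n x =>
  ltac:(by move=> /FP[y /IS yI <-]; apply/FP; exists y)).
have E k x : (x \in I k) = (f x \in F k).
  by apply/idP/idP => [xI|/FP[y yI /finj <-] //]; apply/FP; exists x.
by exists n => m nm x; rewrite !E nP.
Qed.

Lemma dcc_min M (P : submodule M -> Prop) : dcc M -> (exists U, P U) ->
  exists U, P U /\ forall V, P V -> {subset V <= U} -> {subset U <= V}.
Proof.
move=> dM [U0 PU0]; apply: contrapT => nomin.
have H (U : {U | P U}) : exists V : {U | P U},
    {subset sval V <= sval U} /\ ~ {subset sval U <= sval V}.
  apply: contrapT => noV; apply: nomin; exists (sval U); split; first exact: svalP.
  move=> V PV VU; apply: contrapT => nUV; apply: noV.
  by exists (exist _ V PV).
have [s sP] := choice H.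
have [n nP] := dM (fun n => sval (iter n s (exist _ U0 PU0)))
  (fun n => (sP _).1).
have [_ ns] := sP (iter n s (exist _ U0 PU0)).
by apply: ns => x; rewrite -(nP n.+1).
Qed.
End FinGen.

Section Artinian.
Variable R : comPzRingType.
Implicit Types (M N : lmodType R).

Lemma fin_gen_dcc M : artinian_ring R -> fin_gen M -> dcc M.
Proof.
move=> artR [n [v vP]]; elim: n M v vP => [|n IH] M v vP.
  move=> I _; exists 0%N => m _ x.
  have [c] := vP x; rewrite big_ord0 => ->; by rewrite !rpred0.
have L : linear (fun r : R^o => r *: v ord0).
  by move=> a x y; rewrite scalerDl -scalerA.
have [S SP] := im_submodule (Hom_of L).
have dR : dcc R^o by [].
apply: (@dcc_ext _ _ _ _ (Hom_of L) (proj S)) => //.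
  by move=> y /proj_eq0/SP.
apply: (IH _ (fun i => proj S (v (lift ord0 i)))) => y.
have [x <-] := proj_onto y; have [c ->] := vP x.
exists (fun i => c (lift ord0 i)); rewrite Hom_sum big_ord_recl HomZ.
have -> : proj S (v ord0) = 0.
  by apply/proj_eq0/SP; exists 1; rewrite HomofE scale1r.
by rewrite scaler0 add0r; apply: eq_bigr => i _; rewrite HomZ.
Qed.

Fact mulh_linear M (r : R) : linear (fun x : M => r *: x).
Proof. by move=> a x y; rewrite scalerDr !scalerA mulrC. Qed.
Definition mulh M r : Hom M M := Hom_of (@mulh_linear M r).

(** Suppose that N is not finitely generated. A scalar r acts on N as zero or
surjectively, since otherwise its kernel and its image are both proper, hence
finitely generated. In the second case r ^ n = s * r ^ n.+1 for some s and n,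
because R is artinian, so that s inverts r on N. Thus N is a vector space over
a field that is a quotient of R. A complement of a nonzero line is a proper
submodule, hence finitely generated, and then so is N. *)
Lemma dcc_proper_fin_gen N : artinian_ring R ->
  (forall W : submodule N, (exists z, z \notin W) -> fin_gen (subm W)) ->
  fin_gen N.
Proof.
move=> artR Hprop; apply: contrapT => nfg.
(* each scalar acts as zero or invertibly *)
have scal r : (forall z : N, r *: z = 0) \/
    exists s, forall z : N, s *: (r *: z) = z.
  have [K KP] := ker_submodule (mulh N r); have [S SP] := im_submodule (mulh N r).
  have [/existsNP[z nz]|/contrapT K1] := pselect (~ forall z, z \in K); last first.
    by left=> z; apply/KP.
  right.
  have S1 : forall z, z \in S.
    apply: contrapT => /existsNP[y ny]; apply: nfg.
    have [f fP] : exists f : Hom N (subm S), forall x, incl S (f x) = mulh N r x.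
      apply: lift_inj => [|x]; first exact: incl_inj.
      by apply/incl_onto/SP; exists x.
    apply: (@fin_gen_ext _ _ _ _ (incl K) f).
    - move=> x fx; apply/incl_onto/KP; by rewrite -fP fx Hom0.
    - move=> w; have /SP[x xP] := incl_mem w; exists x; apply: incl_inj.
      by rewrite fP.
    - by apply: Hprop; exists z; apply/negP.
    - by apply: Hprop; exists y; apply/negP.
  have HI n : exists I : submodule R^o,
      forall x : R, x \in I <-> exists s : R, x = s * r ^+ n.
    apply: submodule_exists => [|a x y [s ->] [u ->]].
      by exists 0; rewrite mul0r.
    exists (a * s + u); rewrite -[LHS]/(a * (s * r ^+ n) + u * r ^+ n).
    by rewrite mulrDl mulrA.
  have [I IP] := choice HI.
  have [|n nP] := artR I.
    by move=> n x /IP[s ->]; apply/IP; exists (s * r); rewrite exprS mulrA.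
  have /IP[s sP] : r ^+ n \in I n.+1.
    by rewrite nP //; apply/IP; exists 1; rewrite mul1r.
  have rn k : forall z : N, exists y, z = r ^+ k *: y.
    elim: k => [|k IH] u; first by exists u; rewrite scale1r.
    have [y ->] := IH u; have /SP[x <-] := S1 y.
    by exists x; rewrite HomofE scalerA exprSr.
  exists s => u; have [y ->] := rn n u.
  by rewrite !scalerA -mulrA -exprS -sP.
have [x xN0] : exists x : N, x != 0.
  apply: contrapT => N0; apply: nfg; exists 0%N, (fun _ => 0) => x.
  exists (fun _ => 0); rewrite big_ord0; apply: contrapT => /eqP x0; apply: N0.
  by exists x.
have [Z0 Z0P] := @submodule_exists _ N (fun z => z = 0) erefl
  (fun a x y => ltac:(by move=> -> ->; rewrite scaler0 addr0)).
have nxZ0 : x \notin Z0 by apply/negP => /Z0P /eqP; apply/negP.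
pose T := {W : submodule N | x \notin W}.
pose le (W W' : T) : bool := `[< {subset sval W <= sval W'} >].
(* the complement of the line of x is a maximal submodule avoiding x *)
have [|W1 W2 W3 /asboolP H1 /asboolP H2|C Ctot|[W nxW] Wmax] :=
   @ZL_preorder T (exist _ Z0 nxZ0) le.
- by move=> W; apply/asboolP.
- by apply/asboolP => z /H1/H2.
- have [|a u v|U UP] := @submodule_exists _ N
    (fun z => z = 0 \/ exists2 W, C W & z \in sval W).
  + by left.
  + move=> [->|[W CW uW]] [->|[W' CW' vW']].
    * by left; rewrite scaler0 addr0.
    * by right; exists W'; rewrite ?scaler0 ?add0r.
    * by right; exists W; rewrite ?addr0 ?rpredZ.
    * right; have [/asboolP h|/asboolP h] := Ctot _ _ CW CW'.
        by exists W' => //; rewrite rpredD ?rpredZ // h.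
      by exists W => //; rewrite rpredD ?rpredZ // h.
  have nxU : x \notin U.
    apply/negP => /UP[/eqP|[W _ xW]]; first exact/negP.
    by have := svalP W; rewrite xW.
  exists (exist _ U nxU) => W CW; apply/asboolP => z zW; apply/UP; right.
  by exists W.
apply: nfg; apply: (@fin_gen_ext _ _ _ _ (incl W) (proj W)).
- by move=> y /proj_eq0/incl_onto.
- exact: proj_onto.
- by apply: Hprop; exists x.
exists 1%N, (fun _ => proj W x) => w; have [y <-] := proj_onto w.
suff [c yc] : exists c, y - c *: x \in W.
  exists (fun _ => c); rewrite big_ord1 -HomZ; apply/eqP.
  by rewrite -subr_eq0 -HomB; apply/eqP/proj_eq0.
have [yW|nyW] := boolP (y \in W); first by exists 0; rewrite scale0r subr0.
have [|a u v [c cW] [d dW]|V VP] := @submodule_exists _ N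
  (fun z => exists c, z - c *: y \in W).
- by exists 0; rewrite scale0r subr0 rpred0.
- exists (a * c + d).
  by rewrite scalerDl opprD addrACA -scalerA -scalerBr rpredD ?rpredZ.
have xV : x \in V.
  apply: contrapT => /negP nxV; case/negP: nyW.
  have /asboolP H : le (exist _ V nxV) (exist _ W nxW).
    apply: Wmax; apply/asboolP => z zW; apply/VP.
    by exists 0; rewrite scale0r subr0.
  by apply: H; apply/VP; exists 1; rewrite scale1r subrr rpred0.
have /VP[c cW] := xV; have [c0|[s sP]] := scal c.
  by move: cW; rewrite c0 subr0 (negbTE nxW).
exists s; rewrite -rpredN opprB -[y in _ - y]sP -scalerBr rpredZ //.
Qed.

(** A minimal submodule among those that are not finitely generated would
contradict [dcc_proper_fin_gen]. *)
Lemma dcc_fin_gen M : artinian_ring R -> dcc M -> fin_gen M.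
Proof.
move=> artR dM.
suff H (S : submodule M) : fin_gen (subm S).
  have [T TP] := full_submodule M.
  by apply: fin_gen_surj (H T) => y; apply: (incl_onto (TP y)).
apply: contrapT => nS.
have [U [nU Umin]] := dcc_min (P := fun U => ~ fin_gen (subm U)) dM
  (ex_intro _ S nS).
apply: nU; apply: dcc_proper_fin_gen => // W [z nz].
have [V VP] := image_submodule (incl U) W.
have [fgV|nV] := pselect (fin_gen (subm V)); last first.
  case/negP: nz; have /VP[x xW /incl_inj <- //] : incl U z \in V.
  apply: Umin nV _ _ (incl_mem z) => _ /VP[x _ <-]; exact: incl_mem.
have [f fP] : exists f : Hom (subm V) (subm U), forall x, incl U (f x) = incl V x.
  apply: lift_inj => [|x]; first exact: incl_inj.
  have /VP[y _ <-] := incl_mem x; by exists y.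
have fW x : f x \in W.
  by have /VP[y yW] := incl_mem x; rewrite -fP => /incl_inj <-.
have [g gP] : exists g : Hom (subm V) (subm W), forall x, incl W (g x) = f x.
  by apply: lift_inj => [|x]; [exact: incl_inj|apply: incl_onto].
apply: (fin_gen_surj (f := g)) fgV => y.
have /incl_onto[x xP] : incl U (incl W y) \in V.
  by apply/VP; exists (incl W y); rewrite ?incl_mem.
by exists x; apply: incl_inj; rewrite gP; apply: incl_inj; rewrite fP.
Qed.
End Artinian.

(** * Modules over an artin algebra *)

Section Restriction.
Variables (R : comPzRingType) (A : pzRingType) (eta : {rmorphism R -> A}).

Definition res (M : lmodType A) : Type := M.

Section ResModule.
Variable M : lmodType A.
HB.instance Definition _ := GRing.Zmodule.on (res M).
Definition res_scale (r : R) (x : res M) : res M := eta r *: (x : M).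
Fact res_scaleA a b x : res_scale a (res_scale b x) = res_scale (a * b) x.
Proof. by rewrite /res_scale scalerA rmorphM. Qed.
Fact res_scale1 : left_id 1 res_scale.
Proof. by move=> x; rewrite /res_scale rmorph1 scale1r. Qed.
Fact res_scaleDr : right_distributive res_scale +%R.
Proof. by move=> a x y; apply: scalerDr. Qed.
Fact res_scaleDl x : {morph res_scale^~ x : a b / a + b}.
Proof. by move=> a b; rewrite /res_scale rmorphD scalerDl. Qed.
HB.instance Definition _ := GRing.Zmodule_isLmodule.Build R (res M)
  res_scaleA res_scale1 res_scaleDr res_scaleDl.
End ResModule.

Definition resm (M : lmodType A) : lmodType R := res M.

Lemma resZ (M : lmodType A) (r : R) (x : M) : r *: (x : resm M) = eta r *: x :> M.
Proof. by []. Qed.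

Fact res_linear (M N : lmodType A) (f : Hom M N) : linear (f : resm M -> resm N).
Proof. by move=> a x y; rewrite -[LHS]/(f (eta a *: (x : M) + y)) HomD HomZ. Qed.
Definition res_hom (M N : lmodType A) (f : Hom M N) : Hom (resm M) (resm N) :=
  Hom_of (res_linear f).

Lemma res_sub (M : lmodType A) (S : submodule M) :
  exists S' : submodule (resm M), forall x : M, x \in S' <-> x \in S.
Proof.
apply: (@submodule_exists _ (resm M) (fun x : M => x \in S)) => [|a x y xS yS].
  exact: rpred0.
by rewrite resZ rpredD ?rpredZ.
Qed.

Lemma fin_gen_unres (M : lmodType A) : fin_gen (resm M) -> fin_gen M.
Proof.
move=> [n [v vP]]; exists n, v => x; have [c ->] := vP x.
by exists (eta \o c).
Qed.

Lemma dcc_unres (M : lmodType A) : dcc (resm M) -> dcc M.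
Proof.
move=> dM I IS; have [F FP] := choice (fun n => res_sub (I n)).
have [|n nP] := dM F; first by move=> n x /FP/IS/FP.
exists n => m nm x; apply/idP/idP => /FP.
  by rewrite nP // => /FP.
by rewrite -(nP m) // => /FP.
Qed.

Hypothesis hA : artin_algebra eta.

Lemma fin_gen_res (M : lmodType A) : fin_gen M -> fin_gen (resm M).
Proof.
have [_ _ [m [w wP]]] := hA; move=> [n [v vP]].
have [d dP] := choice wP.
apply: (@fin_gen_finType _ _ ('I_n * 'I_m)%type
  (fun p => w p.2 *: v p.1 : resm M)) => x.
have [c cP] := vP x; exists (fun p => d (c p.1) p.2).
rewrite -(pair_bigA _ (fun i j => d (c i) j *: (w j *: v i : resm M))) /= cP.
apply: eq_bigr => i _; rewrite {1}(dP (c i)) scaler_suml.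
by apply: eq_bigr => j _; rewrite resZ scalerA.
Qed.

Lemma artin_dcc (M : lmodType A) : fin_gen M -> dcc M.
Proof.
have [artR _ _] := hA.
by move=> /fin_gen_res /(fin_gen_dcc artR) /dcc_unres.
Qed.

Lemma artin_fin_gen_inj (M N : lmodType A) (f : Hom N M) :
  injective f -> fin_gen M -> fin_gen N.
Proof.
have [artR _ _] := hA.
move=> finj /fin_gen_res /(fin_gen_dcc artR) dM.
apply/fin_gen_unres/dcc_fin_gen => //.
exact: (@dcc_inj _ _ _ (res_hom f)).
Qed.

Lemma iter_HomD (M : lmodType A) (e : Hom M M) n x y :
  iter n e (x + y) = iter n e x + iter n e y.
Proof. by elim: n => //= n ->; rewrite HomD. Qed.
Lemma iter_HomZ (M : lmodType A) (e : Hom M M) n a x :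
  iter n e (a *: x) = a *: iter n e x.
Proof. by elim: n => //= n ->; rewrite HomZ. Qed.
Fact iter_linear (M : lmodType A) (e : Hom M M) n : linear (iter n e).
Proof. by move=> a x y; rewrite iter_HomD iter_HomZ. Qed.

(** Fitting's lemma: for large n the module is the direct sum of the image and
the kernel of the n-th power of e. The images are stationary by the descending
chain condition, the kernels because their union is finitely generated. *)
Lemma fitting (M : lmodType A) (e : Hom M M) :
  fin_gen M -> indecomposable M ->
  bijective e \/ exists n, forall x, iter n e x = 0.
Proof.
move=> fM [_ iM].
pose p n : Hom M M := Hom_of (iter_linear e n).
have pE n x : p n x = iter n e x by [].
have [K KP] := choice (fun n => ker_submodule (p n)).
have [I IP] := choice (fun n => im_submodule (p n)).
have [|n1 n1P] := artin_dcc fM (I := I).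
  by move=> n x /IP[y <-]; apply/IP; exists (e y); rewrite !pE iterSr.
have Kmono n m x : (n <= m)%N -> iter n e x = 0 -> iter m e x = 0.
  move=> /subnK <- x0; rewrite iterD x0; exact: (Hom0 (p _)).
have [|a x y [n nx] [m my]|U UP] := @submodule_exists _ M
  (fun x => exists n, iter n e x = 0).
- by exists 0%N.
- exists (maxn n m); rewrite iter_linear.
  rewrite (Kmono n (maxn n m)) ?leq_maxl // (Kmono m (maxn n m)) ?leq_maxr //.
  by rewrite scaler0 addr0.
have [k [v vP]] := artin_fin_gen_inj (@incl_inj _ _ U) fM.
have [s sP] := choice (fun i => (UP _).1 (incl_mem (v i))).
pose n2 := \max_i s i.
have Un x : x \in U -> iter n2 e x = 0.
  move=> /incl_onto[y <-]; have [c ->] := vP y.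
  rewrite -pE !Hom_sum big1 // => i _; rewrite !HomZ pE (Kmono (s i)) ?scaler0 //.
  exact: leq_bigmax.
(* n is positive so that bijectivity of the n-th power passes to e *)
pose n := (maxn n1 n2).+1.
have n1n : (n1 <= n)%N by apply: leqW; apply: leq_maxl.
have n2n : (n2 <= n)%N by apply: leqW; apply: leq_maxr.
have dec x : exists y, iter n e (x - iter n e y) = 0.
  have /IP[y yP] : iter n e x \in I (n + n)%N.
    rewrite n1P ?(leq_trans n1n) ?leq_addr // -(n1P n) //; apply/IP.
    by exists x.
  by exists y; rewrite -pE HomB !pE -iterD -[X in _ - X]pE yP subrr.
have int y : iter n e (iter n e y) = 0 -> iter n e y = 0.
  by rewrite -iterD => y0; apply: (Kmono n2) => //; apply/Un/UP; exists (n + n)%N.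
have L : linear (fun q : (subm (I n) * subm (K n))%type => incl _ q.1 + incl _ q.2).
  by move=> a x y; rewrite !HomD !HomZ scalerDr addrACA.
have /isom_sym/iM : isom (subm (I n) * subm (K n))%type M.
  apply: (isom_bij (f := Hom_of L)) => [|x].
    apply: Hom_inj => -[x y]; rewrite -[LHS]/(incl (I n) x + incl (K n) y) => xy0.
    have /IP[z zP] := incl_mem x; have /KP yK := incl_mem y.
    have x0 : incl _ x = 0.
      rewrite -zP pE; apply: int; rewrite -pE -[iter n e z]pE zP.
      rewrite -[RHS]oppr0 -yK -HomN; congr (p n _).
      by apply/eqP; rewrite -addr_eq0 xy0.
    have y0 : incl _ y = 0 by move: xy0; rewrite x0 add0r.
    by congr (_, _); apply: incl_inj; rewrite Hom0.
  have [y yP] := dec x.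
  have /incl_onto[u uP] : iter n e y \in I n by apply/IP; exists y.
  have /incl_onto[w wP] : x - iter n e y \in K n by apply/KP.
  by exists (u, w); rewrite -[LHS]/(incl (I n) u + incl (K n) w) uP wP addrC subrK.
move=> [I0|K0]; [right|left].
  exists n => x; have /incl_onto[u uP] : iter n e x \in I n by apply/IP; exists x.
  by rewrite -uP (I0 u) Hom0.
have Kn x : iter n e x = 0 -> x = 0.
  by move=> /KP/incl_onto[u <-]; rewrite (K0 u) Hom0.
have einj : injective e.
  apply: Hom_inj => x x0; apply: Kn; rewrite /n iterSr x0; exact: (Hom0 (p _)).
have es x : exists y, e y = x.
  have [y /Kn/eqP] := dec x; rewrite subr_eq0 => /eqP ->.
  by eexists; rewrite /n iterS.
have [g gP] := choice es; exists g => x; last exact: gP.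
by apply: einj; rewrite gP.
Qed.

Lemma fin_gen_power (N : lmodType R) (I : finType) :
  fin_gen N -> fin_gen (dsum (fun _ : I => N)).
Proof.
move=> [n [v vP]].
apply: (@fin_gen_finType _ _ (I * 'I_n)%type
  (fun p => (fun i => if i == p.1 then v p.2 else 0) : dsum (fun _ : I => N))) => x.
have [c cP] := choice (fun i => vP (x i)).
exists (fun p => c p.1 p.2); apply: dsumP => i.
rewrite sum_dsumE -(pair_bigA _ (fun k j => c k j *: (if i == k then v j else 0))) /=.
rewrite (bigD1 i) //= [X in _ + X]big1 ?addr0 => [|k ki].
  by rewrite {1}cP; apply: eq_bigr => j _; rewrite eqxx.
by rewrite big1 // => j _; rewrite eq_sym (negbTE ki) scaler0.
Qed.

(** Restriction to n generators of M embeds Hom(M, N) into the n-th power of N.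
Its image is an R-submodule, hence finitely generated over R, and R acts on
Hom(M, N) through End(N). *)
Lemma fin_gen_Hom_into (M N : lmodType A) :
  fin_gen M -> fin_gen N -> fin_gen (Hom_into N M).
Proof.
have [artR etaC _] := hA.
move=> [n [v vP]] fN.
have mul_lin r : linear (fun x : N => eta r *: x).
  by move=> a x y; rewrite scalerDr !scalerA etaC.
pose mul r : End N := Hom_of (mul_lin r).
have mulE r x : mul r x = eta r *: x by [].
pose D := dsum (fun _ : 'I_n => resm N).
have fD : fin_gen D by apply/fin_gen_power/fin_gen_res.
have [|a d d' [h hP] [h' hP']|S SP] :=
  @submodule_exists _ D (fun d => exists h : Hom M N, forall i, d i = h (v i)).
- by exists 0.
- exists (comp (mul a) h + h') => i.
  by rewrite add_HomE compE mulE -hP -hP'.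
have [k [w wP]] : fin_gen (subm S).
  apply: dcc_fin_gen => //; apply: dcc_inj (@incl_inj _ _ S) _.
  exact: fin_gen_dcc.
have [g gP] := choice (fun j => (SP _).1 (incl_mem (w j))).
exists k, g => h.
have /incl_onto[y yP] : ((fun i => h (v i)) : D) \in S by apply/SP; exists h.
have [c cP] := wP y; exists (fun j => mul (c j)).
have hv i : h (v i) = \sum_j eta (c j) *: g j (v i).
  have := congr1 (fun d : D => d i) yP; rewrite cP Hom_sum sum_dsumE => <-.
  by apply: eq_bigr => j _; rewrite HomZ -gP.
apply: HomP => x; have [b ->] := vP x.
have E z : (\sum_j mul (c j) *: (g j : Hom_into N M)) z = \sum_j eta (c j) *: g j z.
  exact: (sum_HomE (fun j => comp (mul (c j)) (g j))).
rewrite E Hom_sum.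
under [RHS]eq_bigr => j _ do rewrite Hom_sum scaler_sumr.
rewrite exchange_big /=; apply: eq_bigr => i _.
rewrite HomZ hv scaler_sumr; apply: eq_bigr => j _.
by rewrite HomZ !scalerA etaC.
Qed.
End Restriction.

(** A generating family with the least number of elements is independent: in a
nontrivial relation some coefficient is invertible, and the corresponding
generator is redundant. *)
Lemma division_ring_basis (D : pzRingType) (V : lmodType D) :
  division_ring D -> fin_gen V ->
  exists m (v : 'I_m -> V), (forall x, exists c, x = \sum_i c i *: v i) /\
    forall c, \sum_i c i *: v i = 0 -> forall i, c i = 0.
Proof.
move=> [_ Dinv] [n0 gn0].
pose P n := `[< exists v : 'I_n -> V, forall x, exists c, x = \sum_i c i *: v i >].
have exP : exists n, P n by exists n0; apply/asboolP.
case: (ex_minnP exP) => m /asboolP[v vP] mmin.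
exists m, v; split=> // c c0 k; apply: contrapT => /Dinv[d [dc _]].
case: m v vP mmin c c0 k dc => [|m] v vP mmin c c0 k dc; first by case: k dc.
suff : P m by move=> /mmin; rewrite ltnn.
apply/asboolP; exists (fun i => v (lift k i)) => x.
have [b ->] := vP x.
have vk : v k = - \sum_i (d * c (lift k i)) *: v (lift k i).
  apply/eqP; rewrite -addr_eq0 -[v k]scale1r -dc.
  under eq_bigr => i _ do rewrite -scalerA.
  rewrite -scalerA -scaler_sumr -scalerDr.
  by rewrite -(bigD1_ord k (P := predT) (F := fun i => c i *: v i)) // c0 scaler0.
exists (fun i => b (lift k i) - b k * (d * c (lift k i))).
rewrite (bigD1_ord k) //= vk scalerN scaler_sumr addrC -sumrB.
by apply: eq_bigr => i _; rewrite scalerBl scalerA.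
Qed.

(** * Linear maps to Q over its endomorphism ring *)

Section DirectSumMaps.
Variables (A : pzRingType) (I : finType) (M : I -> lmodType A).

Fact dsum_inj_linear i : linear (fun x : M i => dfwith (0 : dsum M) x : dsum M).
Proof.
move=> a x y; apply: dsumP => j; rewrite -[RHS]/(a *: dfwith _ _ j + dfwith _ _ j).
have [<-|ij] := eqVneq i j; first by rewrite !dfwith_in.
by rewrite !dfwith_out // [X in _ = _ *: X + _]/= scaler0 addr0.
Qed.
Definition dsum_inj i : Hom (M i) (dsum M) := Hom_of (@dsum_inj_linear i).

Fact dsum_prj_linear i : linear (fun x : dsum M => x i).
Proof. by []. Qed.
Definition dsum_prj i : Hom (dsum M) (M i) := Hom_of (@dsum_prj_linear i).

Lemma dsum_injK i x : dsum_prj i (dsum_inj i x) = x.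
Proof. exact: dfwith_in. Qed.
Lemma dsum_inj_out i j x : i != j -> dsum_prj j (dsum_inj i x) = 0.
Proof. by move=> ij; apply: dfwith_out. Qed.
Lemma dsum_sum (x : dsum M) : x = \sum_i dsum_inj i (dsum_prj i x).
Proof.
apply: dsumP => j.
rewrite sum_dsumE (bigD1 j) //= [X in _ + X]big1 ?addr0 => [|i ij].
  exact/esym/dsum_injK.
exact: dsum_inj_out.
Qed.
End DirectSumMaps.
Arguments dsum_inj {A I} M i.
Arguments dsum_prj {A I} M i.

Section Evaluation.
Variables (A : pzRingType) (t : nat) (Q : 'I_t -> lmodType A) (le : rel 'I_t).
Implicit Types (X Y N : lmodType A).
Local Notation DQ := (dsum Q).
Local Notation inj := (dsum_inj Q).
Local Notation prj := (dsum_prj Q).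
Local Notation low i := (fun j => is_true (strict (op_order le) i j)).

(** Linearity over End(Q) of a map that matters only on the subset U of
Hom(X, Q). Keeping phi total lets traces and their filtrations be handled as
predicates on maps. *)
Definition linear_on X (U : Hom X DQ -> Prop) (phi : Hom X DQ -> DQ) : Prop :=
  forall (e : Hom DQ DQ) u v, U u -> U v -> phi (comp e u + v) = e (phi u) + phi v.

Lemma linear_on0 X U (phi : Hom X DQ -> DQ) : linear_on U phi -> U 0 -> phi 0 = 0.
Proof.
move=> H U0; have := H (idh _) _ _ U0 U0.
have -> : comp (idh DQ) 0 + 0 = 0 :> Hom X DQ by apply: HomP => x; rewrite addr0.
by move/eqP; rewrite idhE -subr_eq0 opprD addrA subrr sub0r oppr_eq0 => /eqP.
Qed.

Lemma linear_onZ X U (phi : Hom X DQ -> DQ) e u : linear_on U phi -> U 0 -> U u ->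
  phi (comp e u) = e (phi u).
Proof. by move=> H U0 Uu; rewrite -[comp e u]addr0 H // (linear_on0 H) // addr0. Qed.

Lemma linear_onD X U (phi : Hom X DQ -> DQ) u v : linear_on U phi -> U u -> U v ->
  phi (u + v) = phi u + phi v.
Proof.
by move=> H Uu Uv; rewrite -[phi u]idhE -H //; congr (phi (_ + v)); apply: HomP.
Qed.

Lemma linear_on_sum X (U : Hom X DQ -> Prop) phi (I : finType) (F : I -> Hom X DQ) :
  linear_on U phi -> U 0 -> (forall u v, U u -> U v -> U (u + v)) ->
  (forall i, U (F i)) -> phi (\sum_i F i) = \sum_i phi (F i) /\ U (\sum_i F i).
Proof.
move=> lphi U0 UD UF.
elim/big_rec2: _ => [|i y1 y2 _ [<- Uy]]; first by rewrite (linear_on0 lphi).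
by split; [rewrite (linear_onD lphi) | apply: UD].
Qed.

(** The inclusion of Q i generates Hom(Q i, Q) over End(Q). This is what makes
Hom(Q i, Q) projective and identifies its maps to Q with elements of Q i. *)
Lemma Pbar_gen i (u : Pbar Q i) : u = (comp u (prj i) : End DQ) *: (inj i : Pbar Q i).
Proof.
apply: HomP => x; rewrite -[RHS]/(u (prj i (inj i x))).
by rewrite dsum_injK.
Qed.

Local Notation Tr i := (trace
  (dsum (fun j : {j : 'I_t | strict (op_order le) i j} => Pbar Q (val j)))
  (Pbar Q i)).

(** By [Pbar_gen], a map from Hom(Q j, Q) to Hom(Q i, Q) is composition with a
map from Q i to Q j. *)
Lemma traceP i (u : Hom (Q i) DQ) : (u : Pbar Q i) \in Tr i <-> through Q (low i) u.
Proof.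
split=> [/asboolP|].
  have [||U UP] := @submodule_exists _ (Pbar Q i) (fun u => through Q (low i) u).
  - exact: through0.
  - by move=> e v w Hv Hw; apply: through_add => //; apply: through_post.
  move=> /(_ U) H; apply/UP/H => y [f [x ->]]; apply/UP.
  rewrite (dsum_sum x) Hom_sum; apply: through_sum => j.
  set xj := dsum_prj _ j x.
  rewrite (Pbar_gen xj) !HomZ; set v := f _.
  have -> : (comp xj (prj (val j)) : End DQ) *: v
      = comp xj (comp (prj (val j)) (v : Hom _ _)) by apply: HomP.
  by apply: through_comp; apply: valP.
elim=> [|j a b h Jj _ IH]; first exact: rpred0.
apply: rpredD IH _; apply/asboolP => U; apply.
pose P' (j : {j : 'I_t | strict (op_order le) i j}) := Pbar Q (val j).
pose F := dsum P'.
pose jj : {j : 'I_t | strict (op_order le) i j} := exist _ j Jj.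
have L : linear ((fun y : F => comp (y jj) a) : F -> Pbar Q i).
  by move=> e y y'; apply: HomP.
exists (Hom_of L), (dsum_inj P' jj (b : P' jj) : F).
rewrite HomofE; congr (comp _ a).
exact/esym/(@dsum_injK _ _ P' jj b).
Qed.

Fact Hom_ev_linear X (x : X) :
  linear ((fun u : Hom_into DQ X => u x) : Hom_into DQ X -> evmod DQ).
Proof. by []. Qed.
Definition Hom_ev X (x : X) : Hom (Hom_into DQ X) (evmod DQ) :=
  Hom_of (Hom_ev_linear x).

Lemma Pbar_Hom i (q : Hom (Pbar Q i) (evmod DQ)) (u : Pbar Q i) :
  q u = u (prj i (q (inj i))).
Proof. by rewrite {1}(Pbar_gen u) HomZ. Qed.

(** A linear map from Hom(Q i, Q) to Q is evaluation at some x in Q i. It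
induces a map on the standard module iff every map that factors through the
smaller Q j kills x. *)
Lemma Gbar_standard i :
  exists theta : Hom (Gbar (standard Q (op_order le) i)) (Q i),
    injective theta /\
    forall x, (exists p, theta p = x) <->
      (forall j, low i j -> forall a : Hom (Q i) (Q j), a x = 0).
Proof.
have L : linear (fun p : Gbar (standard Q (op_order le) i) =>
    prj i (p (proj (Tr i) (inj i)))) by [].
have E (p : Gbar (standard Q (op_order le) i)) (u : Pbar Q i) :
    p (proj (Tr i) u) = u (Hom_of L p).
  by rewrite {1}(Pbar_gen u) HomZ HomZ.
exists (Hom_of L); split.
  apply: Hom_inj => p p0; apply: HomP => w; have [u <-] := proj_onto w.
  by rewrite E p0 Hom0.
move=> x; split=> [[p <-] j ij a|Kx].
  have /proj_eq0 H : (comp (inj j) a : Pbar Q i) \in Tr i.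
    by apply/traceP/through_comp.
  by have := E p (comp (inj j) a); rewrite H Hom0 compE => /esym/(congr1 (prj j));
     rewrite dsum_injK Hom0.
have [p pP] : exists p : Hom (standard Q (op_order le) i) (evmod DQ),
   forall u, p (proj (Tr i) u) = Hom_ev x u.
  apply: desc_surj => [|u /proj_eq0/traceP Hu]; first exact: proj_onto.
  by apply: (through_kill (J := low i)) Hu => j a ij; apply: Kx.
exists p; have := E p (inj i); rewrite pP => /(congr1 (prj i)).
by rewrite dsum_injK => <-; apply: dsum_injK.
Qed.

(** The standard module is the quotient of the projective module Hom(Q i, Q) by
its trace, so its extensions by Q split iff each linear map from the trace to
Q extends to Hom(Q i, Q), that is, iff it is an evaluation. *)
Lemma Ext1_standardP i :
  Ext1_zero (standard Q (op_order le) i) (evmod DQ) <->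
  forall phi, linear_on (fun u : Hom (Q i) DQ => through Q (low i) u) phi ->
  exists y, forall u, through Q (low i) u -> phi u = u y.
Proof.
split=> [H phi lphi|H].
  have L : linear ((fun x : subm (Tr i) => phi (incl _ x)) : subm (Tr i) -> evmod DQ).
    move=> e x y; rewrite HomD HomZ; apply: lphi; apply/traceP; exact: incl_mem.
  have [q qP] := Ext1_extends H (Hom_of L) (incl_proj_exact (Tr i)).
  exists (prj i (q (inj i))) => u /traceP/incl_onto[x xu].
  by rewrite -[RHS](Pbar_Hom q u) -xu qP.
apply: extends_Ext1 => X Y f g p fg.
have [finj fE gs] := fg.
(* the projection of Hom(Q i, Q) onto the standard module lifts to Y *)
have [m gm] := gs (proj (Tr i) (inj i)).
have L : linear ((fun u => (comp u (prj i) : End DQ) *: m) : Pbar Q i -> Y).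
  move=> e u v; rewrite scalerA -scalerDl; congr (_ *: m); exact: HomP.
have gL u : g (Hom_of L u) = proj (Tr i) u.
  by rewrite HomofE HomZ gm -HomZ -Pbar_gen.
have ex u : exists x, through Q (low i) u -> f x = Hom_of L u.
  have [Hu|nHu] := pselect (through Q (low i) u); last by exists 0.
  have /fE[x xP] : g (Hom_of L u) = 0 by rewrite gL; apply/proj_eq0/traceP.
  by exists x.
have [s sP] := choice ex.
have [|y yP] := H (fun u => p (s u)).
  move=> e u v Hu Hv.
  have -> : s (comp e u + v) = (e : End DQ) *: s u + s v.
    apply: finj; rewrite HomD HomZ !sP //; last first.
      by apply: through_add => //; apply: through_post.
    by rewrite -HomZ -HomD.
  by rewrite HomD HomZ.
pose h : Hom (X * Pbar Q i)%type Y :=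
  comp f (@fsth _ X (Pbar Q i)) + comp (Hom_of L) (@sndh _ X (Pbar Q i)).
pose k : Hom (X * Pbar Q i)%type (evmod DQ) :=
  comp p (@fsth _ X (Pbar Q i)) + comp (Hom_ev y) (@sndh _ X (Pbar Q i)).
have hE x u : h (x, u) = f x + Hom_of L u by [].
have kE x u : k (x, u) = p x + u y by [].
have [||q qP] := desc_surj (g := h) (p := k).
- move=> w; have [u uP] := proj_onto (g w).
  have /fE[x xP] : g (w - Hom_of L u) = 0 by rewrite HomB gL uP subrr.
  by exists (x, u); rewrite hE xP subrK.
- move=> [x u]; rewrite hE kE => xu.
  have Hu : through Q (low i) u.
    apply/traceP/proj_eq0; rewrite -gL; apply/fE; exists (- x).
    by rewrite HomN; apply/eqP; rewrite eq_sym -addr_eq0 addrC xu.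
  rewrite -yP // -HomD; have -> : x + s u = 0; last exact: Hom0.
  by apply: finj; rewrite HomD Hom0 sP.
by exists q => x; have := qP (x, 0); rewrite hE kE Hom0 addr0 => ->; rewrite addr0.
Qed.

End Evaluation.

(** * Consequences of an Ext-injective stratifying system *)

Definition indexed (A : pzRingType) (t : nat) (T : 'I_t -> lmodType A)
  (J : 'I_t -> Prop) (X : lmodType A) : Prop := exists2 j, J j & X = T j.

Lemma Filt_indexed_sub (A : pzRingType) (t : nat) (T : 'I_t -> lmodType A)
    (J J' : 'I_t -> Prop) X :
  (forall j, J j -> J' j) -> Filt (indexed T J) X -> Filt (indexed T J') X.
Proof. by move=> JJ'; apply: Filt_sub => Y [j /JJ' J'j ->]; exists j. Qed.

Lemma Filt_indexed_ind (A : pzRingType) (t : nat) (T : 'I_t -> lmodType A)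
    (J : 'I_t -> Prop) (P : lmodType A -> Prop) :
  (forall X, is_zero X -> P X) ->
  (forall X1 X j (f : Hom X1 X) (g : Hom X (T j)), short_exact f g ->
     P X1 -> J j -> P X) ->
  forall X, Filt (indexed T J) X -> P X.
Proof.
move=> P0 PS X; elim=> {X}[//|X1 X Y f g fg _ PX1 [j Jj YE]].
by rewrite YE in g fg; apply: PS fg PX1 Jj.
Qed.

(** The data that both implications share: for the first they come with the
stratifying system, for the second they are constructed, and serve there to
prove that Theta i is nonzero and that Hom(Theta i, Theta j) = 0 for j < i. *)
Section Coresolved.
Variables (A : pzRingType) (t : nat) (Q Theta Z : 'I_t -> lmodType A).
Variables (below : 'I_t -> 'I_t -> Prop).
Variables (theta : forall i, Hom (Theta i) (Q i)) (z : forall i, Hom (Q i) (Z i)).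
Implicit Types (X Y N : lmodType A).
Local Notation DQ := (dsum Q).
Local Notation inj := (dsum_inj Q).
Local Notation prj := (dsum_prj Q).
Hypothesis exTheta : forall i, short_exact (theta i) (z i).
Hypothesis FZ : forall i, Filt (indexed Theta (below i)) (Z i).
Hypothesis extTheta : forall i, Ext1_zero (Theta i) DQ.

Lemma Filt_Ext_dsum J X : Filt (indexed Theta J) X -> Ext1_zero X DQ.
Proof. by apply: Filt_Ext_l => _ [j _ ->]. Qed.

(** A nonzero element of X that vanishes in the top factor comes from X1. There
a map to some Q k detects it, and this map extends to X. *)
Lemma Filt_cogenerated J X : Filt (indexed Theta J) X ->
  forall x, x != 0 -> exists j, J j /\ exists g : Hom X (Q j), g x != 0.
Proof.
move: X; apply: Filt_indexed_ind => [Y Y0|X1 Y j f p fp IH Jj] x.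
  by rewrite (Y0 x) eqxx.
move=> x0; have [finj fE ps] := fp.
have [px|px] := eqVneq (p x) 0; last first.
  exists j; split=> //; exists (comp (theta j) p); rewrite compE.
  have [tinj _ _] := exTheta j.
  by apply: contra px => /eqP /(Hom_inj0 tinj) ->.
have /fE[x1 x1P] := px.
have [|k [Jk [g gx]]] := IH x1.
  by apply: contra x0 => /eqP x10; rewrite -x1P x10 Hom0.
have [q qP] := Ext1_extends (@extTheta j) (comp (inj k) g) fp.
exists k; split=> //; exists (comp (prj k) q).
by rewrite compE -x1P qP compE dsum_injK.
Qed.

(** A decomposition of the restriction of h to X1 extends to X. The difference
factors through the top factor Theta j, and extends from there to Q j. *)
Lemma Filt_through J X : Filt (indexed Theta J) X ->
  forall h : Hom X DQ, through Q J h.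
Proof.
move: X; apply: Filt_indexed_ind => [Y Y0|X1 Y j f p fp IH Jj] h.
  by rewrite (is_zero_Hom_l Y0 h); apply: through0.
have [finj fE ps] := fp.
have [h' Hh' hh'] : exists2 h' : Hom Y DQ, through Q J h' & comp h' f = comp h f.
  elim: (IH (comp h f)) => [|k a b h1 Jk _ [h2 Hh2 <-]].
    by exists 0; [exact: through0|apply: HomP].
  have [q qP] := Ext1_extends (@extTheta j) (comp (inj k) a) fp.
  exists (h2 + comp b (comp (prj k) q)); first exact: throughD.
  apply: HomP => x; rewrite compE !add_HomE !compE qP compE dsum_injK.
  by [].
have [w wP] : exists w : Hom (Theta j) DQ, forall x, w (p x) = (h - h') x.
  apply: desc_surj => // _ /fE[x <-].
  by rewrite add_HomE opp_HomE -!compE hh' subrr.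
have [q qP] := Ext1_extends (Filt_Ext_dsum (FZ j)) w (exTheta j).
have -> : h = h' + comp q (comp (theta j) p).
  apply: HomP => x; rewrite add_HomE !compE qP wP add_HomE opp_HomE.
  by rewrite addrC subrK.
exact: throughD.
Qed.

Let lin X phi := linear_on (fun _ : Hom X DQ => True) phi.

(** Composed with the restriction from Hom(Q j, Q), the map phi becomes
evaluation at some y in Q j. This y is killed by all maps that vanish on
Theta j, so it lies in Theta j because Z j is cogenerated by the Q k. *)
Lemma Theta_reflexive j (phi : Hom (Theta j) DQ -> DQ) : lin phi ->
  exists x, forall u, phi u = u x.
Proof.
move=> lphi; have [tinj tE zs] := exTheta j.
pose y := prj j (phi (comp (inj j) (theta j))).
have hy (h : Hom (Q j) DQ) : phi (comp h (theta j)) = h y.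
  rewrite -[RHS](compE h (prj j)) -(linear_onZ _ lphi) //; congr phi.
  by apply: HomP => x; rewrite !compE dsum_injK.
have /tE[x xP] : z j y = 0.
  apply/eqP; apply: contrapT => /negP zy.
  have [k [_ [g gy]]] := Filt_cogenerated (FZ j) zy.
  case/negP: gy; have := hy (comp (inj k) (comp g (z j))).
  have -> : comp (comp (inj k) (comp g (z j))) (theta j) = 0.
    by apply: HomP => x; rewrite !compE (exact0 _ (exTheta j)) !Hom0.
  rewrite (linear_on0 lphi) // !compE => /(congr1 (prj k)).
  by rewrite dsum_injK Hom0 => <-.
exists x => u.
have [h hP] := Ext1_extends (Filt_Ext_dsum (FZ j)) u (exTheta j).
have -> : u = comp h (theta j) by apply: HomP => v; rewrite compE hP.
by rewrite hy compE xP.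
Qed.

(** An X with this property is reflexive for the duality Hom(-, Q). The step
combines reflexivity of the top factor and of X1, as in the five lemma. *)
Lemma Filt_reflexive J X : Filt (indexed Theta J) X ->
  forall phi : Hom X DQ -> DQ, lin phi -> exists x, forall u, phi u = u x.
Proof.
move: X; apply: Filt_indexed_ind => [Y Y0|X1 Y j f p fp IH Jj] phi lphi.
  by exists 0 => u; rewrite (is_zero_Hom_l Y0 u) (linear_on0 lphi).
have [finj fE ps] := fp.
have [|y yP] := @Theta_reflexive j (fun w => phi (comp w p)).
  move=> e u v _ _; have -> : comp (comp e u + v) p = comp e (comp u p) + comp v p.
    exact: HomP.
  exact: lphi.
have [x xP] := ps y.
(* after this correction phi' vanishes on maps through the top factor *)
pose phi' (u : Hom Y DQ) := phi u - u x.
have lphi' : lin phi'.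
  move=> e u v _ _; rewrite /phi' lphi // add_HomE compE HomB.
  by rewrite opprD addrACA.
have eqphi' (u v : Hom Y DQ) : (forall x, u (f x) = v (f x)) -> phi' u = phi' v.
  move=> uv.
  have [w wP] : exists w : Hom (Theta j) DQ, forall x, w (p x) = (u - v) x.
    by apply: desc_surj => // _ /fE[x' <-]; rewrite add_HomE opp_HomE uv subrr.
  have -> : u = comp w p + v.
    by apply: HomP => x'; rewrite add_HomE compE wP add_HomE opp_HomE subrK.
  rewrite (linear_onD lphi') // [phi' (comp w p)](_ : _ = 0) ?add0r //.
  by rewrite /phi' yP compE xP subrr.
have [ext extP] := choice (fun u : Hom X1 DQ => Ext1_extends (@extTheta j) u fp).
have [|x1 x1P] := IH (fun u => phi' (ext u)).
  move=> e u v _ _; rewrite -lphi' //; apply: eqphi' => x'.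
  by rewrite extP !add_HomE !compE !extP.
exists (x + f x1) => u.
rewrite HomD -[u (f x1)](compE u f) -x1P -[LHS](subrK (u x)) addrC; congr (_ + _).
by apply: eqphi' => x'; rewrite extP.
Qed.
End Coresolved.

Lemma isom_same_image (A : pzRingType) (M N X : lmodType A)
    (f : Hom M X) (g : Hom N X) : injective f -> injective g ->
  (forall x, (exists m, f m = x) <-> (exists n, g n = x)) -> isom M N.
Proof.
move=> finj ginj fg.
have [h hP] : exists h : Hom M N, forall x, g (h x) = f x.
  by apply: lift_inj => // x; apply/fg; exists x.
apply: (isom_bij (f := h)) => [x y /(congr1 g)|y]; first by rewrite !hP => /finj.
have /fg[x xy] : exists n, g n = g y by exists y.
by exists x; apply: ginj; rewrite hP.
Qed.

Section Necessity.
Variables (A : pzRingType) (t : nat) (Q Theta : 'I_t -> lmodType A).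
Variables (le : rel 'I_t).
Hypothesis H : ext_inj_stratifying Theta Q le.
Local Notation DQ := (dsum Q).
Local Notation Delta i := (standard Q (op_order le) i).
Let below i : 'I_t -> Prop := fun j => strict (op_order le) i j.

Let data i : {Z : lmodType A & {f : Hom (Theta i) (Q i) & {g : Hom (Q i) Z |
   short_exact f g /\ Filt (indexed Theta (below i)) Z}}}.
Proof.
have [Z /cid[f /cid[g [fg /filtered_Filt FZ]]]] := cid (eis_exact H i).
exists Z, f, g; split=> //; apply: Filt_sub FZ => _ [j ji ->]; exists j => //.
by move: ji; rewrite /below /strict /op_order eq_sym.
Qed.
Let Z i := projT1 (data i).
Let theta i : Hom (Theta i) (Q i) := projT1 (projT2 (data i)).
Let z i : Hom (Q i) (Z i) := sval (projT2 (projT2 (data i))).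
Let exTheta i : short_exact (theta i) (z i).
Proof. by case: (svalP (projT2 (projT2 (data i)))). Qed.
Let FZ i : Filt (indexed Theta (below i)) (Z i).
Proof. by case: (svalP (projT2 (projT2 (data i)))). Qed.
Let extTheta i := @eis_Ext _ _ _ _ _ H i.

Let HomTheta i j : below i j -> Hom_zero_only (Theta i) (Theta j).
Proof. by move=> ij; apply: (eis_Hom H); move: ij; rewrite /below /strict eq_sym. Qed.

Let below_trans i j k : below i j -> below j k -> below i k.
Proof.
have [refl anti tr tot] := eis_order H.
rewrite /below /strict /op_order => /andP[ij ji] /andP[jk kj].
rewrite (tr j) // andbT; apply: contra jk => /eqP ik.
by apply/eqP/anti; rewrite kj andbT -ik ji.
Qed.

Let HomThetaQ i j : below i j -> Hom_zero_only (Theta i) (Q j).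
Proof.
move=> ij; apply: Hom0_ext_r (exTheta j) (HomTheta ij) _.
apply: Filt_Hom0_r (FZ j) => _ [k jk ->].
exact/HomTheta/(below_trans ij).
Qed.

(** Theta i has no nonzero map to a smaller Q j, since Q j is filtered by the
Theta k with k at most j. Conversely, an element outside Theta i is detected
by a map of Z i to a smaller Q j. *)
Lemma eis_image i x : (exists y, theta i y = x) <->
  forall j, below i j -> forall a : Hom (Q i) (Q j), a x = 0.
Proof.
have [_ tE _] := exTheta i.
split=> [[y <-] j ij a|Kx].
  by rewrite -compE (HomThetaQ ij (comp a (theta i))).
apply/tE/eqP; apply: contrapT => /negP zx.
have [j [ij [g gz]]] := Filt_cogenerated exTheta extTheta (FZ i) zx.
by case/negP: gz; rewrite -compE Kx.
Qed.

Lemma eis_isom_Gbar i : isom (Theta i) (Gbar (Delta i)).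
Proof.
have [th [thinj thE]] := Gbar_standard Q le i.
have [tinj _ _] := exTheta i.
apply: isom_same_image tinj thinj _ => x.
by split=> [/eis_image/thE|/thE/eis_image].
Qed.

(** The trace in Hom(Q i, Q) consists of the maps that vanish on Theta i, that
is, of the maps from Z i to Q; so reflexivity of Z i represents phi by an
element of Z i. *)
Lemma eis_Ext_standard i : Ext1_zero (Delta i) (evmod DQ).
Proof.
apply/Ext1_standardP => phi lphi.
have thr := Filt_through exTheta FZ extTheta (FZ i).
have [|z0 z0P] := Filt_reflexive exTheta FZ extTheta (FZ i)
   (phi := fun w => phi (comp w (z i))).
  move=> e u v _ _.
  have -> : comp (comp e u + v) (z i) = comp e (comp u (z i)) + comp v (z i).
    exact: HomP.
  by apply: lphi; apply: through_pre; apply: thr.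
have [_ tE zs] := exTheta i.
have [y yP] := zs z0; exists y => u Hu.
have [w wP] : exists w : Hom (Z i) DQ, forall x, w (z i x) = u x.
  apply: desc_surj => // _ /tE[x <-].
  apply: (through_kill (J := below i)) Hu => j a ij.
  by rewrite -compE (HomThetaQ ij (comp a (theta i))).
have -> : u = comp w (z i) by apply: HomP => x; rewrite compE wP.
by rewrite z0P compE yP.
Qed.

Lemma eis_Ext_Gbar i : Ext1_zero (Gbar (Delta i)) DQ.
Proof. exact: Ext1_zero_isom (eis_isom_Gbar i) (@extTheta i). Qed.
End Necessity.

(** * Induction along a finite linear order *)

Section LinearOrder.
Variables (t : nat) (le : rel 'I_t).
Hypothesis le_lin : linear_order le.
Local Notation below i := (fun j => is_true (strict (op_order le) i j)).
Local Notation upto i := (fun j => is_true (le j i)).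

Lemma below_le i j : below i j -> le j i.
Proof. by move=> /andP[]. Qed.

Lemma below_irr i : ~ below i i.
Proof. by rewrite /strict eqxx. Qed.

Lemma below_le_trans i j k : below j k -> le j i -> below i k.
Proof.
have [refl anti tr tot] := le_lin; rewrite /strict /op_order => /andP[jk kj] ji.
rewrite (tr j) // andbT; apply: contra jk => /eqP ik.
by apply/eqP/anti; rewrite kj andbT -ik ji.
Qed.

Lemma le_below_trans i j k : le k j -> below i j -> below i k.
Proof.
have [refl anti tr tot] := le_lin; rewrite /strict /op_order => kj /andP[ij ji].
rewrite (tr j) // andbT; apply: contra ij => /eqP ik.
by apply/eqP/anti; rewrite ji andbT ik kj.
Qed.

Lemma below_trans i j k : below i j -> below j k -> below i k.
Proof. by move=> ij jk; apply: below_le_trans jk (below_le ij). Qed.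

Lemma le_or_below i j : le i j \/ below i j.
Proof.
have [refl anti tr tot] := le_lin.
have [/eqP ->|ij] := boolP (i == j); first by left; apply: refl.
by have /orP[|ji] := tot i j; [left | right; rewrite /strict ij].
Qed.

Lemma le_eq_or_below i j : le j i -> i = j \/ below i j.
Proof.
move=> ji; have [/eqP ->|ij] := boolP (i == j); first by left.
by right; rewrite /strict ij.
Qed.

Let rank i := #|[pred j | strict (op_order le) i j]|.

Let rank_lt i j : below i j -> (rank j < rank i)%N.
Proof.
move=> ij; apply/proper_card/properP; split.
  by apply/fintype.subsetP => k; rewrite !inE; apply: below_trans.
by exists j; rewrite !inE //; apply/negP/below_irr.
Qed.

(** In a finite linear order a nonempty set of predecessors is a closed initial
segment. *)
Lemma below_max i j : below i j ->
  exists2 k, below i k & (fun j => is_true (strict (op_order le) i j)) = upto k.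
Proof.
move=> ij.
case: (@arg_maxnP _ j (fun j => strict (op_order le) i j) rank ij) => k ik kmax.
exists k => //; apply/funext => m; apply/propext; split=> [im|mk].
  have [//|/rank_lt mk] := le_or_below m k.
  by have := leq_trans mk (kmax m im); rewrite ltnn.
exact: le_below_trans mk ik.
Qed.

(** Induction along the initial segments contained in the predecessors of i. *)
Lemma below_ind i (P : ('I_t -> Prop) -> Prop) :
  P (fun _ => False) ->
  (forall k, below i k -> P (below k) -> P (upto k)) -> P (below i).
Proof.
move=> P0 PS.
suff H n k : (rank k <= n)%N -> le k i -> P (below k).
  by apply: (H (rank i)) => //; have [] := le_lin.
elim: n k => [|n IH] k kn ki.
  have -> : (below k) = (fun _ => False); last exact: P0.
  apply/funext => j; apply/propext; split=> // /rank_lt jk.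
  by have := leq_trans jk kn.
have [[j kj]|nj] := pselect (exists j, below k j); last first.
  have -> : (below k) = (fun _ => False); last exact: P0.
  by apply/funext => j; apply/propext; split=> // kj; apply: nj; exists j.
have [m km ->] := below_max kj.
apply: PS; first exact: below_le_trans km ki.
apply: IH; first by rewrite -ltnS (leq_trans (rank_lt km)).
by apply: below_le; apply: below_le_trans km ki.
Qed.

Lemma below_ind_down i (P : ('I_t -> Prop) -> Prop) :
  P (below i) ->
  (forall k, below i k -> P (upto k) -> P (below k)) ->
  forall k, below i k -> P (upto k).
Proof.
move=> Pi PS.
(* upward induction on the implication from P J to P on smaller segments *)
apply: (@below_ind i (fun J => P J -> forall k, J k -> P (upto k))) => //.
move=> k ik IH Pk j jk.
have [<-//|kj] := le_eq_or_below jk.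
by apply: IH => //; apply: PS.
Qed.
End LinearOrder.

(** * The stratifying system of a proper costratifying system *)

Section ProperCostratifying.
Variables (R : comPzRingType) (A : pzRingType) (eta : {rmorphism R -> A}).
Hypothesis hA : artin_algebra eta.
Variables (t : nat) (Psi Q : 'I_t -> lmodType A) (le : rel 'I_t).
Hypothesis H : proper_costratifying Psi Q le.
Implicit Types (X Y N : lmodType A).
Local Notation DQ := (dsum Q).
Local Notation inj := (dsum_inj Q).
Local Notation prj := (dsum_prj Q).
Local Notation below i := (fun j => is_true (strict (op_order le) i j)).
Local Notation upto i := (fun j => is_true (le j i)).
Local Notation from i := (fun j => is_true (le i j)).
Let le_lin := pcs_order H.

Let data i : {W : lmodType A & {f : Hom W (Q i) & {g : Hom (Q i) (Psi i) |
   short_exact f g /\ Filt (indexed Psi (upto i)) W}}}.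
Proof.
have [W /cid[f /cid[g [fg /filtered_Filt FW]]]] := cid (pcs_exact H i).
by exists W, f, g.
Qed.
Let W i := projT1 (data i).
Let w i : Hom (W i) (Q i) := projT1 (projT2 (data i)).
Let pi i : Hom (Q i) (Psi i) := sval (projT2 (projT2 (data i))).
Let wpi i : short_exact (w i) (pi i).
Proof. by case: (svalP (projT2 (projT2 (data i)))). Qed.
Let FW i : Filt (indexed Psi (upto i)) (W i).
Proof. by case: (svalP (projT2 (projT2 (data i)))). Qed.

Let FQ i : Filt (indexed Psi (upto i)) (Q i).
Proof.
by apply: Filt_step (wpi i) (FW i) _; exists i => //; have [] := le_lin.
Qed.

Lemma HomPsi i j : below i j -> Hom_zero_only (Psi j) (Psi i).
Proof. by move=> ij; apply: (pcs_Hom H); move: ij; rewrite /strict eq_sym. Qed.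

(** Q j is filtered by the Psi k with k at most j. *)
Lemma HomQPsi i j : below i j -> Hom_zero_only (Q j) (Psi i).
Proof.
move=> ij; apply: Filt_Hom0_l (FQ j) => _ [k kj ->].
exact/HomPsi/(le_below_trans le_lin kj).
Qed.

Lemma Ext_Q_Filt i J X : Filt (indexed Psi J) X -> Ext1_zero (Q i) X.
Proof. by apply: Filt_Ext_r => _ [j _ ->]; apply: (pcs_Ext H). Qed.

Let pi_nz i : pi i <> 0.
Proof.
move=> pi0; have [one_nz _] := pcs_End H i; apply: one_nz.
apply: HomP => x; have [_ _ ps] := wpi i; have [y <-] := ps x.
by rewrite pi0 !Hom0.
Qed.

(** Psi k behaves as a simple object among the modules filtered by the Psi j
with j at most k. If g vanishes on X1 then it factors through the top factor
Psi j; this forces j = k, and g is then the top projection up to an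
automorphism of Psi k. Otherwise the kernel of g is an extension of the top
factor by the kernel on X1. *)
Lemma brick_epi k X (g : Hom X (Psi k)) :
  Filt (indexed Psi (upto k)) X -> g <> 0 ->
  exists N (n : Hom N X), short_exact n g /\ Filt (indexed Psi (upto k)) N.
Proof.
move=> FX; move: X FX g.
suff : forall X, Filt (indexed Psi (upto k)) X ->
  Filt (indexed Psi (upto k)) X /\ forall g : Hom X (Psi k), g <> 0 ->
  exists N (n : Hom N X), short_exact n g /\ Filt (indexed Psi (upto k)) N.
  by move=> S X /S[].
apply: Filt_indexed_ind => [X X0|X1 X j f p fp [FX1 IH] jk].
  by split=> [|g []]; [exact: Filt_zero | apply: is_zero_Hom_l].
split=> [|g g0]; first by apply: Filt_step fp FX1 _; exists j.
have [finj fE ps] := fp.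
have [gf0|gf] := pselect (comp g f = 0).
  have [u uP] : exists u : Hom (Psi j) (Psi k), forall x, u (p x) = g x.
    by apply: desc_surj => // _ /fE[x <-]; rewrite -compE gf0.
  have gE : g = comp u p by apply: HomP => x; rewrite compE uP.
  have u0 : u <> 0 by move=> u0; apply: g0; rewrite gE u0; apply: HomP.
  have [jE|/HomPsi/(_ u)//] := le_eq_or_below jk.
  exists X1, f; split=> //; rewrite gE; apply: exact_isom_right fp.
  move: u u0 {uP gE}; rewrite -jE => u u0.
  have [_ /(_ u u0)[v [vu uv]]] := pcs_End H k.
  exists v => x; first exact: (congr1 (fun h : End (Psi k) => h x) vu).
  exact: (congr1 (fun h : End (Psi k) => h x) uv).
have [N1 [n1 [nE1 FN1]]] := IH _ gf.
have [n1inj n1E gfs] := nE1.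
have [N [n nE]] : exists (N : lmodType A) (n : Hom N X), short_exact n g.
  by apply: ker_exact => y; have [x <-] := gfs y; exists (f x).
have [ninj nE' gs] := nE.
exists N, n; split=> //.
have [l lP] : exists l : Hom N1 N, forall x, n (l x) = comp f n1 x.
  apply: lift_inj => // x; apply/nE'; rewrite -compE.
  exact: (exact0 x nE1).
apply: (@Filt_step _ _ _ _ _ l (comp p n) _ FN1); last by exists j.
split.
- by move=> x y /(congr1 n); rewrite !lP => /finj/n1inj.
- move=> y; rewrite compE; split=> [/fE[x1 x1P]|[x <-]]; last first.
    by rewrite lP compE (exact0 _ fp).
  have /n1E[x0 x0P] : comp g f x1 = 0 by rewrite compE x1P (exact0 _ nE).
  by exists x0; apply: ninj; rewrite lP compE x0P.
- move=> z; have [x <-] := ps z; have [x1 x1P] := gfs (g x).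
  have /nE'[y yP] : g (x - f x1) = 0 by rewrite HomB -x1P subrr.
  by exists y; rewrite compE yP HomB (exact0 _ fp) subr0.
Qed.

(** If p does not factor through pi, it maps the kernel of pi onto Psi k, with
a kernel to which maps from Q k lift. This gives an endomorphism e of Q k with
pi e = pi and p e = 0. It is not nilpotent, since pi is nonzero, so it is
bijective by Fitting's lemma and p = 0. *)
Lemma Hom_Q_Psi_one_dim k (p : Hom (Q k) (Psi k)) :
  exists c : Hom (Psi k) (Psi k), p = comp c (pi k).
Proof.
have [winj wE pis] := wpi k.
have [pw0|pw] := pselect (comp p (w k) = 0).
  have [u uP] : exists u : Hom (Psi k) (Psi k), forall x, u (pi k x) = p x.
    by apply: desc_surj => // _ /wE[x <-]; rewrite -compE pw0.
  by exists u; apply: HomP => x; rewrite compE uP.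
have [N [n [nE FN]]] := brick_epi (FW k) pw.
have [u uP] := Ext1_lifts (Ext_Q_Filt (i := k) FN) p nE.
pose e : Hom (Q k) (Q k) := idh _ - comp (w k) u.
have pie x : pi k (e x) = pi k x.
  by rewrite /e add_HomE opp_HomE HomB compE (exact0 _ (wpi k)) subr0.
have pe x : p (e x) = 0.
  by rewrite /e add_HomE opp_HomE HomB compE -uP compE subrr.
have [[e' _ e'K]|[m m0]] := fitting hA e (pcs_Q_fin_gen H k) (pcs_Q_indec H k).
  by exists 0; apply: HomP => x; rewrite -[x]e'K pe.
case: (@pi_nz k); apply: HomP => x.
have -> : pi k x = pi k (iter m e x) by elim: m {m0} => //= m ->; rewrite pie.
by rewrite m0 Hom0.
Qed.

(** Hom(Q i, Psi k) is finite-dimensional over the division ring End(Psi k), and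
its elements lift along pi. *)
Lemma Hom_Q_Psi_basis i k : exists m (f : 'I_m -> Hom (Q i) (Q k)),
  (forall p : Hom (Q i) (Psi k), exists c : 'I_m -> Hom (Psi k) (Psi k),
     p = \sum_l comp (c l) (comp (pi k) (f l))) /\
  (forall c : 'I_m -> Hom (Psi k) (Psi k),
     \sum_l comp (c l) (comp (pi k) (f l)) = 0 -> forall l, c l = 0).
Proof.
have [m [v [vgen vind]]] := division_ring_basis (pcs_End H k)
  (fin_gen_Hom_into hA (pcs_Q_fin_gen H i) (pcs_Psi_fin_gen H k)).
have [f fP] := choice (fun l =>
  Ext1_lifts (Ext_Q_Filt (i := i) (FW k)) (v l : Hom _ _) (wpi k)).
have E l : comp (pi k) (f l) = v l by apply: HomP => x; rewrite compE fP.
exists m, f; split=> [p|c c0].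
  have [c cP] := vgen p; exists c; rewrite {1}cP.
  by apply: eq_bigr => l _; rewrite E.
apply: vind; rewrite -[RHS]c0.
by apply: eq_bigr => l _; rewrite E.
Qed.

Let bas i k := cid (Hom_Q_Psi_basis i k).
Let dm i k : nat := sval (bas i k).
Let bas2 i k := cid (svalP (bas i k)).

(** The multiplicity of the k-th standard module in Hom(Q i, Q) is [dm i k];
the maps [b] represent the corresponding generators. *)
Let b i k : 'I_(dm i k) -> Hom (Q i) (Q k) := sval (bas2 i k).
Let b_gen i k (p : Hom (Q i) (Psi k)) :
  exists c : 'I_(dm i k) -> Hom (Psi k) (Psi k),
     p = \sum_l comp (c l) (comp (pi k) (b l)).
Proof. by have [h _] := svalP (bas2 i k); apply: h. Qed.
Let b_ind i k (c : 'I_(dm i k) -> Hom (Psi k) (Psi k)) :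
     \sum_l comp (c l) (comp (pi k) (b l)) = 0 -> forall l, c l = 0.
Proof. by have [_ h] := svalP (bas2 i k); apply: h. Qed.

(** Correcting h by suitable multiples of the maps [b] makes it vanish in the
top factor. *)
Lemma decompose_step i j J X1 X (f : Hom X1 X) (p : Hom X (Psi j))
    (h : Hom (Q i) X) :
  short_exact f p -> Filt (indexed Psi J) X1 ->
  exists (h1 : Hom (Q i) X1) (g : 'I_(dm i j) -> Hom (Q j) X),
    h = comp f h1 + \sum_l comp (g l) (b l).
Proof.
move=> fp FX1; have [finj fE ps] := fp.
have [c cP] := b_gen (comp p h).
have [g gP] := choice (fun l =>
  Ext1_lifts (Ext_Q_Filt (i := j) FX1) (comp (c l) (pi j)) fp).
have [h1 h1P] : exists h1 : Hom (Q i) X1, forall x,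
    f (h1 x) = (h - \sum_l comp (g l) (b l)) x.
  apply: lift_inj => // x; apply/fE.
  rewrite add_HomE opp_HomE HomB -[p (h x)]compE cP !sum_HomE Hom_sum.
  apply/eqP; rewrite subr_eq0; apply/eqP; apply: eq_bigr => l _.
  by rewrite !compE gP.
exists h1, g; apply: HomP => x.
by rewrite add_HomE compE h1P add_HomE opp_HomE subrK.
Qed.

Lemma Filt_Psi_through i J X (h : Hom (Q i) X) :
  Filt (indexed Psi J) X -> through Q J h.
Proof.
move=> FX; move: X FX h.
suff : forall X, Filt (indexed Psi J) X -> Filt (indexed Psi J) X /\
   forall h : Hom (Q i) X, through Q J h by move=> S X /S[].
apply: Filt_indexed_ind => [X X0|X1 X j f p fp [FX1 IH] Jj].
  by split=> [|h]; [exact: Filt_zero|rewrite (is_zero_Hom_r X0 h); exact: through0].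
split=> [|h]; first by apply: Filt_step fp FX1 _; exists j.
have [h1 [g ->]] := decompose_step h fp FX1.
apply: through_add; first exact: through_post.
by apply: through_sum => l; apply: through_comp.
Qed.

(** Contributions of factors Psi j with j smaller than k go into r. *)
Lemma upto_decompose i k X (h : Hom (Q i) X) : Filt (indexed Psi (upto k)) X ->
  exists (g : 'I_(dm i k) -> Hom (Q k) X) (r : Hom (Q i) X),
    through Q (below k) r /\ h = \sum_l comp (g l) (b l) + r.
Proof.
move=> FX; move: X FX h.
suff : forall X, Filt (indexed Psi (upto k)) X -> Filt (indexed Psi (upto k)) X /\
   forall h : Hom (Q i) X,
   exists (g : 'I_(dm i k) -> Hom (Q k) X) (r : Hom (Q i) X),
     through Q (below k) r /\ h = \sum_l comp (g l) (b l) + r.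
  by move=> S X /S[].
apply: Filt_indexed_ind => [X X0|X1 X j f p fp [FX1 IH] jk].
  split=> [|h]; first exact: Filt_zero.
  exists (fun=> 0), 0; split; first exact: through0.
  by apply: HomP => x; exact: (etrans (X0 _) (esym (X0 _))).
split=> [|h]; first by apply: Filt_step fp FX1 _; exists j.
have [h1 [g ->]] := decompose_step h fp FX1.
have [g1 [r1 [Hr1 ->]]] := IH h1.
have fE : comp f (\sum_l comp (g1 l) (b l) + r1) =
    \sum_l comp (comp f (g1 l)) (b l) + comp f r1.
  apply: HomP => x; rewrite compE add_HomE HomD sum_HomE Hom_sum add_HomE sum_HomE.
  by [].
have [jE|kj] := le_eq_or_below jk.
  move: p g fp; rewrite -jE => p g fp.
  exists (fun l => comp f (g1 l) + g l), (comp f r1).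
  split; first exact: through_post.
  rewrite fE addrAC -big_split /=; congr (_ + _); apply: eq_bigr => l _.
  exact: HomP.
exists (fun l => comp f (g1 l)), (comp f r1 + \sum_l comp (g l) (b l)); split.
  apply: through_add; first exact: through_post.
  by apply: through_sum => l; apply: through_comp.
by rewrite fE addrA.
Qed.

(** Since Ext^1(Q j, X) = 0, Ext^1(Psi j, X) is a quotient of Hom(W j, X),
where W j is the kernel of pi. This Hom group vanishes as all factors of W j are
smaller than all factors of X. *)
Lemma Ext_Psi_from j k X : below k j -> Filt (indexed Psi (from k)) X ->
  Ext1_zero (Psi j) X.
Proof.
move=> kj FX; have [winj wE pis] := wpi j.
apply: lifts_Ext1 => B D f g p fg; have [finj fE gs] := fg.
have [q qP] := Ext1_lifts (Ext_Q_Filt (i := j) FX) (comp p (pi j)) fg.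
have HWX : Hom_zero_only (W j) X.
  apply: Filt_Hom0_l (FW j) => _ [m mj ->].
  apply: Filt_Hom0_r FX => _ [n kn ->].
  apply: HomPsi; apply: (le_below_trans le_lin mj).
  exact: (below_le_trans le_lin kj).
have [u uP] : exists u : Hom (W j) X, forall x, f (u x) = comp q (w j) x.
  apply: lift_inj => // x; apply/fE; rewrite compE qP compE.
  by rewrite (exact0 _ (wpi j)) Hom0.
have [v vP] : exists v : Hom (Psi j) B, forall x, v (pi j x) = q x.
  by apply: desc_surj => // _ /wE[x <-]; rewrite -compE -uP (HWX u) Hom0.
by exists v => x; have [y <-] := pis x; rewrite vP qP.
Qed.

(** The small factors can be moved to the bottom of the filtration, because
they have no extensions by modules with large factors only. *)
Lemma split_filtration k X : Filt (indexed Psi (fun _ => True)) X ->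
  exists (X' Y : lmodType A) (s : Hom X' X) (v : Hom X Y), [/\ short_exact s v,
    Filt (indexed Psi (below k)) X' & Filt (indexed Psi (from k)) Y].
Proof.
move: X; apply: Filt_indexed_ind => [X X0|X1 X j f p fp IH _].
  have [N [n nE]] := ker_exact (f := idh X) (fun y => ex_intro _ y (idhE y)).
  exists N, X, n, (idh X); split=> //; apply: Filt_zero => // x.
  by have [ninj _ _] := nE; apply: ninj; rewrite Hom0; apply: (exact0 x nE).
have [X' [Y [s [v [sv FX' FY]]]]] := IH.
have [sinj sE vs] := sv; have [finj fE ps] := fp.
have [kj|kj] := le_or_below le_lin k j.
  have [Y' [f' [p' [v' [f'p' v'f p'v' v'0 v's]]]]] := pushout v fp.
  exists X', Y', (comp f s), v'; split=> //; last first.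
    by apply: Filt_step f'p' FY _; exists j.
  split.
  - by move=> x y /finj/sinj.
  - move=> y; split=> [/v'0[x [<- /sE[z <-]]]|[x <-]]; first by exists z.
    by rewrite compE v'f (exact0 _ sv) Hom0.
  - move=> y'; have [n [y ->]] := v's y'; have [x <-] := vs n.
    by exists (f x + y); rewrite HomD v'f.
have [v' v'P] := Ext1_extends (Ext_Psi_from kj FY) v fp.
have [N [n nE]] : exists (N : lmodType A) (n : Hom N X), short_exact n v'.
  by apply: ker_exact => y; have [x <-] := vs y; exists (f x).
have [ninj nE' v's] := nE.
exists N, Y, n, v'; split=> //.
have [l lP] : exists l : Hom X' N, forall x, n (l x) = comp f s x.
  by apply: lift_inj => // x; apply/nE'; rewrite compE v'P (exact0 _ sv).
apply: (@Filt_step _ _ _ _ _ l (comp p n) _ FX'); last by exists j.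
split.
- by move=> x y /(congr1 n); rewrite !lP => /finj/sinj.
- move=> y; rewrite compE; split=> [/fE[x1 x1P]|[x <-]]; last first.
    by rewrite lP compE (exact0 _ fp).
  have /sE[x0 x0P] : v x1 = 0 by rewrite -v'P x1P (exact0 _ nE).
  by exists x0; apply: ninj; rewrite lP compE x0P.
- move=> z; have [x <-] := ps z; have [x1 x1P] := vs (v' x).
  have /nE'[y yP] : v' (x - f x1) = 0 by rewrite HomB v'P x1P subrr.
  by exists y; rewrite compE yP HomB (exact0 _ fp) subr0.
Qed.

(** A map from Q k to a factor Psi j of X vanishes for j above k, and is a
multiple of pi for j = k. In the second case independence of the basis of
Hom(Q i, Psi k) applies. *)
Lemma from_independent i k X : Filt (indexed Psi (from k)) X ->
  forall g : 'I_(dm i k) -> Hom (Q k) X,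
  \sum_l comp (g l) (b l) = 0 -> forall l, g l = 0.
Proof.
move: X; apply: Filt_indexed_ind => [X X0 g _ l|X1 X j f p fp IH kj g g0].
  exact: is_zero_Hom_r.
have [finj fE ps] := fp.
have pg l : comp p (g l) = 0.
  have [jE|jk] := le_eq_or_below kj; last exact: HomQPsi.
  move: p fp {ps fE}; rewrite jE => p fp.
  have [c cP] := choice (fun l => Hom_Q_Psi_one_dim (comp p (g l))).
  rewrite cP (b_ind (c := c)); first exact: HomP.
  apply: HomP => x; rewrite zero_HomE sum_HomE.
  have := congr1 (fun h : Hom (Q i) X => p (h x)) g0.
  rewrite sum_HomE Hom_sum /= Hom0 => E; rewrite -[RHS]E; apply: eq_bigr => m _.
  by rewrite -[LHS](compE (comp (c m) (pi k))) -cP.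
have [g1 g1P] := choice (fun l => lift_inj (p := g l) finj
  (fun x => (fE (g l x)).1 (congr1 (fun h : Hom (Q k) (Psi j) => h x) (pg l)))).
move=> l; apply: HomP => x; rewrite -g1P (IH g1) ?Hom0 //.
apply: HomP => y; apply: finj; rewrite sum_HomE Hom_sum Hom0.
have := congr1 (fun h : Hom (Q i) X => h y) g0; rewrite sum_HomE => E.
by rewrite -[RHS]E; apply: eq_bigr => m _; rewrite !compE g1P.
Qed.

(** Maps that factor through smaller Q j vanish in the part Y of X with large
factors, so that [from_independent] applies there. Conversely, maps into the
part X' with small factors factor through the smaller Q j. *)
Lemma below_independent_Filt i k X (g : 'I_(dm i k) -> Hom (Q k) X) :
  Filt (indexed Psi (fun _ => True)) X ->
  through Q (below k) (\sum_l comp (g l) (b l)) ->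
  forall l, through Q (below k) (g l).
Proof.
move=> /(split_filtration k)[X' [Y [s [v [sv FX' FY]]]]] Hg l.
have [sinj sE vs] := sv.
have vg : forall l, comp v (g l) = 0.
  apply: (from_independent FY (g := fun l => comp v (g l))).
  apply: etrans (through_Hom0 v _ Hg) => [|j kj].
    by apply: HomP => x; rewrite compE !sum_HomE Hom_sum.
  apply: Filt_Hom0_r FY => _ [m km ->].
  exact/HomQPsi/(below_le_trans le_lin kj).
have [g' g'P] : exists g' : Hom (Q k) X', forall x, s (g' x) = g l x.
  by apply: lift_inj => // x; apply/sE; rewrite -compE vg.
have -> : g l = comp s g' by apply: HomP => x; rewrite compE g'P.
by apply: through_post; apply: Filt_Psi_through FX'.
Qed.

(** Together with [upto_through_decompose] this says that the trace filtration
of Hom(Q i, Q) has direct sums of standard modules as its factors. *)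
Lemma below_independent i k (g : 'I_(dm i k) -> Hom (Q k) DQ) :
  through Q (below k) (\sum_l comp (g l) (b l)) ->
  forall l, through Q (below k) (g l).
Proof.
move=> Hg l.
have -> : g l = \sum_j comp (inj j) (comp (prj j) (g l)).
  by apply: HomP => x; rewrite sum_HomE {1}(dsum_sum (g l x)).
apply: through_sum => j; apply: through_post.
apply: (below_independent_Filt (g := fun l => comp (prj j) (g l))).
  by apply: Filt_indexed_sub (FQ j).
have -> : \sum_l comp (comp (prj j) (g l)) (b l)
    = comp (prj j) (\sum_l comp (g l) (b l)).
  by apply: HomP => x; rewrite compE !sum_HomE Hom_sum.
exact: through_post.
Qed.

Lemma upto_through_decompose i k (u : Hom (Q i) DQ) : through Q (upto k) u ->
  exists (g : 'I_(dm i k) -> Hom (Q k) DQ) (r : Hom (Q i) DQ),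
    through Q (below k) r /\ u = r + \sum_l comp (g l) (b l).
Proof.
elim=> [|j a c h jk _ [g [r [Hr ->]]]].
  exists (fun=> 0), 0; split; first exact: through0.
  by apply: HomP => x; rewrite add_HomE sum_HomE big1 ?addr0.
have [jE|kj] := le_eq_or_below jk; last first.
  exists g, (r + comp c a); split; last by rewrite addrAC.
  by apply: through_add => //; apply: through_comp.
move: a c; rewrite -jE => a c.
have [g' [r' [Hr' ->]]] := upto_decompose a (FQ k).
exists (fun l => g l + comp c (g' l)), (r + comp c r'); split.
  by apply: through_add => //; apply: through_post.
apply: HomP => x; rewrite !add_HomE !compE !sum_HomE !add_HomE !HomD sum_HomE Hom_sum.
rewrite [X in _ = _ + X](eq_bigr
  (fun l => comp (g l) (b l) x + c (comp (g' l) (b l) x))) //.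
rewrite big_split /= -!addrA; congr (_ + _).
by rewrite [RHS]addrC addrA.
Qed.

(** By [Ext1_standardP], the vanishing of Ext^1 on the i-th standard module is
[evaluable] for i and the predecessors of i. *)
Definition evaluable i (J : 'I_t -> Prop) : Prop :=
  forall phi, linear_on (fun u : Hom (Q i) DQ => through Q J u) phi ->
  exists x, forall u, through Q J u -> phi u = u x.

(** The conditions on y make phi extend to the maps that factor through the
Q j with j at most k, sending h b_l to h (y l); the extension is well defined
by [below_independent]. *)
Lemma evaluable_extend i k (phi : Hom (Q i) DQ -> DQ) (y : 'I_(dm i k) -> Q k) :
  evaluable i (upto k) ->
  linear_on (fun u => through Q (below k) u) phi ->
  (forall l (h : Hom (Q k) DQ), through Q (below k) h ->
     phi (comp h (b l)) = h (y l)) ->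
  exists x, (forall u, through Q (below k) u -> phi u = u x) /\
    forall l, b l x = y l.
Proof.
move=> ev lphi phiy.
have sub u : through Q (below k) u -> through Q (upto k) u.
  by apply: through_mono => j /below_le.
(* the graph of the extension of phi *)
pose dec (u : Hom (Q i) DQ) v :=
  exists (g : 'I_(dm i k) -> Hom (Q k) DQ) (r : Hom (Q i) DQ),
  [/\ through Q (below k) r, u = r + \sum_l comp (g l) (b l)
    & v = phi r + \sum_l g l (y l)].
have decD e u v u' v' : dec u v -> dec u' v' -> dec (comp e u + u') (e v + v').
  move=> [g [r [Hr -> ->]]] [g' [r' [Hr' -> ->]]].
  exists (fun l => comp e (g l) + g' l), (comp e r + r'); split.
  - by apply: through_add => //; apply: through_post.
  - apply: HomP => x; rewrite !add_HomE !compE !add_HomE !sum_HomE !HomD Hom_sum.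
    rewrite [X in _ = _ + X](eq_bigr
      (fun l => e (comp (g l) (b l) x) + comp (g' l) (b l) x)) //.
    by rewrite big_split /= addrACA.
  - rewrite lphi // HomD Hom_sum.
    rewrite [X in _ = _ + X](eq_bigr (fun l => e (g l (y l)) + g' l (y l))) //.
    by rewrite big_split /= addrACA.
have dec0 v : dec 0 v -> v = 0.
  move=> [g [r [Hr r0 ->]]].
  have rE : r = - \sum_l comp (g l) (b l) by apply/eqP; rewrite -addr_eq0 -r0.
  have Hs : through Q (below k) (\sum_l comp (g l) (b l)).
    by rewrite -[\sum_l _]opprK -rE; apply: through_opp.
  have Hg := below_independent Hs.
  have [||l|E _] := linear_on_sum (F := fun l => comp (g l) (b l)) lphi.
  - exact: through0.
  - by move=> u u'; apply: through_add.
  - exact: through_pre.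
  rewrite -(eq_bigr _ (fun l _ => phiy l _ (Hg l))) -E.
  rewrite -(linear_onD lphi) // -r0 (linear_on0 lphi) //; exact: through0.
have dec_uniq u v v' : dec u v -> dec u v' -> v = v'.
  move=> Hv Hv'; have := decD (- idh DQ) _ _ _ _ Hv Hv'.
  have -> : comp (- idh DQ) u + u = 0 by apply: HomP => x; apply: addNr.
  by move/dec0/eqP; rewrite opp_HomE addrC subr_eq0 => /eqP.
have ex u : exists v, through Q (upto k) u -> dec u v.
  have [/upto_through_decompose[g [r [Hr E]]]|nu] := pselect (through Q (upto k) u).
    by exists (phi r + \sum_l g l (y l)) => _; exists g, r.
  by exists 0.
have [psi psiP] := choice ex.
have [|x xP] := ev psi.
  move=> e u v Hu Hv; apply: (dec_uniq (comp e u + v)); last first.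
    exact/decD/psiP/Hv/psiP.
  by apply: psiP; apply: through_add => //; apply: through_post.
exists x; split=> [u Hu|l].
  rewrite -xP; last exact: sub.
  apply: (dec_uniq u); last exact/psiP/sub.
  exists (fun=> 0), u; split=> //; last by rewrite big1 ?addr0.
  by apply: HomP => v; rewrite add_HomE sum_HomE big1 ?addr0.
have Hbl : through Q (upto k) (comp (inj k) (b l)).
  by apply: through_comp; have [] := le_lin.
have := xP _ Hbl.
rewrite (dec_uniq (comp (inj k) (b l)) _ (inj k (y l)) (psiP _ Hbl)).
  by move=> /(congr1 (prj k)); rewrite compE !dsum_injK.
exists (fun m => if m == l then inj k else 0), 0; split; first exact: through0.
- apply: HomP => v; rewrite add_HomE sum_HomE add0r (bigD1 l) //= eqxx.
  rewrite big1 ?addr0 // => m ml; rewrite (negbTE ml) //.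
- rewrite (linear_on0 lphi); last exact: through0.
  rewrite add0r (bigD1 l) //= eqxx.
  rewrite big1 ?addr0 // => m ml; rewrite (negbTE ml) //.
Qed.

(** Descend from i. To pass from the segment up to k to the predecessors of k,
the values y l are provided by the case of k itself. *)
Lemma evaluable_upto i k : (forall j, evaluable j (below j)) -> below i k ->
  evaluable i (upto k).
Proof.
move=> ev; apply: (below_ind_down le_lin (P := evaluable i)) => //.
move=> {}k ik evk phi lphi.
have [y yP] : exists y : 'I_(dm i k) -> Q k, forall l (h : Hom (Q k) DQ),
    through Q (below k) h -> phi (comp h (b l)) = h (y l).
  suff H' l : exists y, forall h : Hom (Q k) DQ,
      through Q (below k) h -> phi (comp h (b l)) = h y.
    by have [y yP] := choice H'; exists y.
  apply: (ev k (fun h => phi (comp h (b l)))) => e u v Hu Hv.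
  have -> : comp (comp e u + v) (b l) = comp e (comp u (b l)) + comp v (b l).
    exact: HomP.
  by apply: lphi; apply: through_pre.
have [x [xP _]] := evaluable_extend evk lphi yP.
by exists x.
Qed.

(** The kernels of all maps from Q i to the Q j, for j in growing initial
segments, filter the quotient of Q i by the image of Theta i. From the
predecessors of k to the segment up to k, one divides further by the kernels
of the maps b_l, one at a time; each of them is onto Theta k, because
[evaluable_extend] with phi = 0 provides elements on which the b_l have
prescribed values in Theta k. *)
Lemma standard_filtration (Theta : 'I_t -> lmodType A)
    (theta : forall i, Hom (Theta i) (Q i)) :
  (forall i, injective (theta i)) ->
  (forall i x, (exists y, theta i y = x) <->
     forall j, below i j -> forall a : Hom (Q i) (Q j), a x = 0) ->
  (forall j, evaluable j (below j)) ->
  forall i, exists (Z : lmodType A) (z : Hom (Q i) Z),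
     short_exact (theta i) z /\ Filt (indexed Theta (below i)) Z.
Proof.
move=> thinj thE ev i.
suff : forall L : submodule (Q i),
    (forall x, x \in L <->
       forall j, below i j -> forall a : Hom (Q i) (Q j), a x = 0) ->
    Filt (indexed Theta (below i)) (quotm L).
  move=> S; have [||L LP] := @submodule_exists _ _
     (fun x => forall j, below i j -> forall a : Hom (Q i) (Q j), a x = 0).
  - by move=> j _ a; apply: Hom0.
  - by move=> e x y Kx Ky j ij a; rewrite HomD HomZ Kx // Ky // scaler0 addr0.
  exists (quotm L), (proj L); split; last exact: S.
  split=> [|x|z]; [exact: thinj| |exact: proj_onto].
  by split=> [/proj_eq0/LP/thE|/thE/LP/proj_eq0].
apply: (below_ind le_lin (P := fun J => forall L : submodule (Q i),
    (forall x, x \in L <-> forall j, J j -> forall a : Hom (Q i) (Q j), a x = 0) ->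
    Filt (indexed Theta J) (quotm L))) => [L LP|k ik IH L LP].
  by apply: Filt_zero => z; have [x <-] := proj_onto z; apply/proj_eq0/LP.
pose K x := forall j, below k j -> forall a : Hom (Q i) (Q j), a x = 0.
have [M MP] : exists M : nat -> submodule (Q i), forall n x,
    x \in M n <-> K x /\ forall l : 'I_(dm i k), (l < n)%N -> b l x = 0.
  suff HM n : exists M : submodule (Q i), forall x,
      x \in M <-> K x /\ forall l : 'I_(dm i k), (l < n)%N -> b l x = 0.
    by have [M MP] := choice HM; exists M.
  apply: submodule_exists => [|e x y [Kx xn] [Ky yn]].
    by split=> [j _ a|l _]; apply: Hom0.
  split=> [j kj a|l ln]; first by rewrite HomD HomZ Kx // Ky // scaler0 addr0.
  by rewrite HomD HomZ xn // yn // scaler0 addr0.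
have -> : L = M (dm i k).
  apply: submodule_eq => x; rewrite LP MP; split=> [Kx|[Kx xn] j jk a].
    split=> [j kj a|l _]; last by apply: Kx; have [] := le_lin.
    by apply: Kx; apply: below_le.
  have [jE|kj] := le_eq_or_below jk; last exact: Kx.
  move: a; rewrite -jE => a.
  have [g [r [Hr ->]]] := upto_decompose a (FQ k).
  have rx : r x = 0 by apply: through_kill Hr => m km c; apply: Kx.
  rewrite add_HomE rx addr0 sum_HomE big1 // => l _.
  by rewrite compE xn ?Hom0.
suff S n : (n <= dm i k)%N -> Filt (indexed Theta (upto k)) (quotm (M n)).
  exact: S.
elim: n => [_|n IHn lt_n].
  apply: (@Filt_indexed_sub _ _ _ (below k)) => [j /below_le //|].
  by apply: IH => x; rewrite MP; split=> [[]|Kx]; last split.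
pose l := Ordinal lt_n.
have [g gP] : exists g : Hom (subm (M n)) (Theta k),
    forall x, theta k (g x) = b l (incl _ x).
  apply: (@lift_inj _ _ _ _ (theta k) (comp (b l) (incl (M n)))) => // x.
  have /MP[Kx _] := incl_mem x.
  by apply/thE => j kj a; rewrite -compE; apply: (Kx j kj (comp a (b l))).
have gE x : g x = 0 <-> incl (M n) x \in M n.+1.
  have /MP[Kx xn] := incl_mem x.
  rewrite MP; split=> [gx|[_ bx]]; last first.
    by apply: thinj; rewrite gP bx // Hom0.
  split=> // m; rewrite ltnS leq_eqVlt => /orP[/eqP ml|/xn //].
  have -> : m = l by apply: val_inj.
  by rewrite -gP gx Hom0.
apply: (Filt_quot_step (g := g)) gE _ _ _; last exact/IHn/ltnW.
- move=> y.
  have killed (h : Hom (Q k) DQ) : through Q (below k) h -> h (theta k y) = 0.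
    by apply: through_kill => j a kj; apply: ((thE k _).1) => //; exists y.
  have [||x [xP bx]] := @evaluable_extend i k (fun=> 0)
    (fun m => if m == l then theta k y else 0) (evaluable_upto ev ik).
  + by move=> e u v _ _; rewrite Hom0 addr0.
  + by move=> m h /killed hy; case: eqP => _; rewrite ?hy ?Hom0.
  have /incl_onto[x' x'P] : x \in M n.
    apply/MP; split=> [j kj a|m mn].
      have := xP (comp (inj j) a) (through_comp _ _ kj).
      by move=> /(congr1 (prj j)); rewrite Hom0 compE dsum_injK => <-.
    by rewrite bx; case: eqP => // ml; move: mn; rewrite ml ltnn.
  by exists x'; apply: thinj; rewrite gP x'P bx eqxx.
- by move=> x /MP[Kx xn]; apply/MP; split=> // m mn; apply: xn; apply: leqW.
- by apply: Filt_class; exists k; have [] := le_lin.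
Qed.

(** If Theta i were zero, Q i would be filtered by the smaller Theta j, its
identity would factor through the smaller Q j, and pi would vanish. A map from
Theta i to a smaller Theta j extends to a map from Q i to Q j, and such maps
kill Theta i. *)
Lemma exists_ext_inj_stratifying :
  (forall i, Ext1_zero (standard Q (op_order le) i) (evmod DQ)) ->
  (forall i, Ext1_zero (Gbar (standard Q (op_order le) i)) DQ) ->
  ext_inj_stratifying (fun i => Gbar (standard Q (op_order le) i)) Q le.
Proof.
move=> b1 b2; pose Theta i : lmodType A := Gbar (standard Q (op_order le) i).
pose th i := cid (Gbar_standard Q le i).
pose theta i : Hom (Theta i) (Q i) := sval (th i).
have thinj i : injective (theta i) by have [] := svalP (th i).
have thE i x : (exists y, theta i y = x) <->
     forall j, below i j -> forall a : Hom (Q i) (Q j), a x = 0.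
  by have [_ h] := svalP (th i); apply: h.
have ev j : evaluable j (below j) by apply/Ext1_standardP/b1.
pose F i := cid (standard_filtration thinj thE ev i).
pose Z i := sval (F i); pose F2 i := cid (svalP (F i)).
pose z i : Hom (Q i) (Z i) := sval (F2 i).
have exT i : short_exact (theta i) (z i) by have [] := svalP (F2 i).
have FZ i : Filt (indexed Theta (below i)) (Z i) by have [] := svalP (F2 i).
have extT i : Ext1_zero (Theta i) DQ by apply: b2.
have Qnz i : ~ is_zero (Q i) by have [] := pcs_Q_indec H i.
split=> //.
- by move=> i; apply: (artin_fin_gen_inj hA (@thinj i)); apply: (pcs_Q_fin_gen H).
- exact: (pcs_Q_fin_gen H).
- move=> i T0; have [_ zE zs] := exT i.
  have QZ : isom (Z i) (Q i).
    apply/isom_sym/(isom_bij (f := z i)) => //; apply: Hom_inj => x /zE[y <-].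
    by rewrite (T0 y) Hom0.
  have Hi : through Q (below i) (inj i).
    exact: (Filt_through exT FZ extT (Filt_isom QZ (FZ i))).
  apply: (@pi_nz i).
  have pi0 : comp (comp (pi i) (prj i)) (inj i) = 0.
    by apply: through_Hom0 Hi => j; apply: HomQPsi.
  by apply: HomP => x; rewrite -[x]dsum_injK -!compE pi0.
- exact: (pcs_Q_indec H).
- move=> i j ji h; have ij : below i j by move: ji; rewrite /strict eq_sym.
  have [q qP] := Ext1_extends (Filt_Ext_dsum extT (FZ i))
    (comp (inj j) (comp (theta j) h)) (exT i).
  apply: HomP => x; apply: (@thinj j); apply: etrans (esym (Hom0 _)).
  rewrite -[LHS](dsum_injK (M := Q)) -[X in prj j X](qP x).
  by apply: ((thE i (theta i x)).1 _ j ij (comp (prj j) q)); exists x.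
- move=> i; exists (Z i), (theta i), (z i); split; first exact: exT.
  apply: Filt_filtered; apply: Filt_sub (FZ i) => _ [j ij ->]; exists j => //.
  by move: ij; rewrite /strict eq_sym.
Qed.
End ProperCostratifying.

Theorem theorem5p1 (R : comPzRingType) (Lambda : pzRingType)
    (eta : {rmorphism R -> Lambda}) (hLambda : artin_algebra eta)
    (t : nat) (Psi Q : 'I_t -> lmodType Lambda) (le : rel 'I_t)
    (hPsiQ : proper_costratifying Psi Q le)
    (hQ : forall i j, i <> j -> ~ isom (Q i) (Q j)) :
  let Delta := standard Q (op_order le) in
  ((exists Theta : 'I_t -> lmodType Lambda, ext_inj_stratifying Theta Q le)
   <->
   (forall i, Ext1_zero (Delta i) (evmod (dsum Q)) /\
              Ext1_zero (Gbar (Delta i)) (dsum Q)))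
  /\
  (forall Theta : 'I_t -> lmodType Lambda, ext_inj_stratifying Theta Q le ->
    (forall i, isom (Theta i) (Gbar (Delta i))) /\
    (forall Theta' : 'I_t -> lmodType Lambda,
       ext_inj_stratifying Theta' Q le ->
       forall i, isom (Theta i) (Theta' i))).
Proof.
move=> Delta; split; last first.
  move=> Theta HT; split=> [i|Theta' HT' i]; first exact: eis_isom_Gbar.
  exact: isom_trans (eis_isom_Gbar HT i) (isom_sym (eis_isom_Gbar HT' i)).
split=> [[Theta HT] i|H].
  by split; [apply: (eis_Ext_standard HT)|apply: (eis_Ext_Gbar HT)].
exists (fun i => Gbar (Delta i)).
by apply: (exists_ext_inj_stratifying hLambda hPsiQ) => i; have [] := H i.
Qed.
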